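(* Let $A:D(A)\subseteq\mathcal H\to\mathcal H$ be an injective self-adjoint operator on a complex Hilbert space $\mathcal H$, let $\mathcal X$ be a complex Banach space, and let $\tau:D(A)\to\mathcal X$ be a continuous linear map (with respect to the graph norm on $D(A)$) such that: (h1) $\tau$ is surjective; (h2) $\mathrm{Range}(\tau')\cap\mathcal H'=\{0\}$; (h3) there is a constant $c>0$ with $\|\tau\phi\|_{\mathcal X}\le c\,\|A\phi\|_{\mathcal H}$ for all $\phi\in D(A)$. Let $\Theta$ be a self-adjoint conjugate-linear operator from $D(\Theta)\subseteq\mathcal X'$ to $\mathcal X$. Let $D(A^\tau_\Theta)$ be the set of $\phi\in\mathcal H$ for which there exist $\phi_{\rm reg}\in\widehat D(A)$ and $Q_\phi\in D(\Theta)$ such that $$\phi-G(z)Q_\phi=\phi_{\rm reg}+K(z)Q_\phi$$ (where $z\in\rho(A)$; the condition and the pair $(\phi_{\rm reg},Q_\phi)$ do not depend on the choice of $z$) and $$\tau\phi_{\rm reg}=\Theta\,Q_\phi .$$ Then $$A^\tau_\Theta:D(A^\tau_\Theta)\subseteq\mathcal H\to\mathcal H,\qquad A^\tau_\Theta\,\phi:=A\,\phi_{\rm reg},$$ is a self-adjoint operator which coincides with $A$ on the kernel of $\tau$ (that is, on $\{\phi\in D(A):\tau\phi=0\}$), and its resolvent $R^\tau_\Theta(z)=(-A^\tau_\Theta+z)^{-1}$ is given by $$R^\tau_\Theta(z)=R(z)+G(z)\,(\Theta+\Gamma(z))^{-1}\,\breve G(z),\qquad z\in W_\Theta^-\cup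 W_\Theta^+\cup(\mathbb C\setminus\mathbb R),$$ where $\Gamma(z):=\tau\, K(z)$.
   Context: Scalar products are conjugate linear in the first variable. $\mathcal X'$ is the strong dual of $\mathcal X$; $^*$ on scalars is complex conjugation. $C_{\mathcal H}:\mathcal H\to\mathcal H'$ is the conjugate-linear isomorphism $(C_{\mathcal H}y)(x)=\langle y,x\rangle$. $J_{\mathcal X}:\mathcal X\to\mathcal X''$ is $(J_{\mathcal X}x)(\ell)=\ell(x)$. Banach adjoints: for a densely defined linear operator $L$ from $\mathcal X_1$ to $\mathcal X_2$, $L':D(L')\subseteq\mathcal X_2'\to\mathcal X_1'$ satisfies $(L'\ell)(x)=\ell(Lx)$; for a densely defined conjugate-linear $L$, $L'$ satisfies $(L'\ell)(x)=(\ell(Lx))^*$ ($x\in D(L)$, $\ell\in D(L')$). A closed densely defined (linear or conjugate-linear) operator $L$ from $\mathcal X'$ to $\mathcal X$ is called self-adjoint if $J_{\mathcal X}L=L'$. For self-adjoint $L$ put $\gamma(L):=\inf\{\ell(L\ell):\ell\in D(L),\ \|\ell\|_{\mathcal X'}=1\}$. $D(A)$ is a Hilbert space with the graph norm $\|\phi\|_A^2=\|\phi\|^2_{\mathcal H}+\|A\phi\|^2_{\mathcal H}$. In (h2), $\tau':\mathcal X'\to D(A)'$ and $\mathcal H'$ is embedded in $D(A)'$ by $\varphi\mapsto\langle C_{\mathcal H}^{-1}\varphi,\cdot\rangle_{\mathcal H}$; (h2) is equivalent to density of $\{\phi\in D(A):\tau\phi=0\}$ in $\mathcal H$. $\widehat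 D(A)$ is the completion of $D(A)$ in the norm $\|\phi\|_{(A)}=\|A\phi\|_{\mathcal H}$, with canonical embedding $\mathcal I:D(A)\to\widehat D(A)$. By (h3), $\tau$ extends continuously to $\widehat D(A)\to\mathcal X$, and $A$ extends continuously to $\widehat D(A)\to\mathcal H$; the extensions are denoted by the same symbols $\tau$ and $A$. For $\phi\in\mathcal H$ and $\psi\in\widehat D(A)$, writing $\phi=\psi$ means $\phi\in D(A)$ and $\mathcal I\phi=\psi$. For $z$ in the resolvent set $\rho(A)$: $R(z):=(-A+z)^{-1}:\mathcal H\to D(A)$; $\breve G(z):=\tau R(z):\mathcal H\to\mathcal X$ (bounded linear); $G(z):=C_{\mathcal H}^{-1}\,\breve G(z^* )':\mathcal X'\to\mathcal H$ (bounded conjugate-linear). For any sequence of nonzero reals $\epsilon_n\to0$, the limit $R\phi:=\lim_n R(i\epsilon_n)\phi$ exists in $\widehat D(A)$ for every $\phi\in\mathcal H$ and defines a bounded linear operator $R:\mathcal H\to\widehat D(A)$. Put $K(z):=z\,R\,G(z):\mathcal X'\to\widehat D(A)$ (bounded conjugate-linear). $W^\pm_\Theta:=\{\lambda\in\mathbb R\cap\rho(A):\gamma(\pm\Gamma(\lambda))>-\gamma(\pm\Theta)\}$. *)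

(* Defs.v *)
From HB Require Import structures.
From mathcomp Require Import all_boot all_order all_algebra complex.
From mathcomp Require Import all_classical all_reals ereal topology normedtype.

Set Implicit Arguments.
Unset Strict Implicit.
Unset Printing Implicit Defensive.

Import Order.TTheory GRing.Theory Num.Theory.
Import numFieldNormedType.Exports.

Local Open Scope classical_set_scope.
Local Open Scope complex_scope.
Local Open Scope ring_scope.

Definition bounded_functional (R : realType) (V : normedModType R[i]) :
  {pred V -> R[i]^o} := fun f => `[< linear f /\ continuous f >].

Arguments bounded_functional {R} V.

Section dual_type.
Context {R : realType}.
Variable V : normedModType R[i].

Lemma bounded_functionalP (f : V -> R[i]^o) :
  reflect (linear f /\ exists M : R[i], forall x, `|f x| <= M * `|x|)
          (f \in bounded_functional V).
Proof.
apply: (iffP (asboolP _)) => -[lf].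
  pose fL := GRing.isLinear.Build R[i] V R[i]^o *:%R f lf.
  pose g : {linear V -> R[i]^o} := HB.pack f fL.
  move=> cf; split=> //.
  have /linear_boundedP : bounded_near g (nbhs 0).
    by apply: continuous_linear_bounded => //; exact: cf.
  by move=> /pinfty_ex_gt0[M _ gM]; exists M.
case=> M fM; split => //.
pose fL := GRing.isLinear.Build R[i] V R[i]^o *:%R f lf.
pose g : {linear V -> R[i]^o} := HB.pack f fL.
have : bounded_near g (nbhs 0).
  apply/linear_boundedP; have [V0|[x0 x00]] :
      (forall x : V, x = 0) \/ exists x : V, x != 0.
  - have [h|h] := pselect (exists x : V, x != 0); [by right|left=> x].
    by apply/eqP; apply: contra_notT h => x0; exists x.
  - near=> r => x; rewrite (V0 x) linear0 !normr0 mulr0//.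
  - have M0 : 0 <= M.
      have := le_trans (normr_ge0 _) (fM x0).
      by rewrite pmulr_lge0// normr_gt0.
    near=> r => x; apply: le_trans (fM x) _; rewrite ler_wpM2r//.
    by near: r; apply: nbhs_pinfty_ge; exact: ger0_real.
by move/bounded_linear_continuous.
Unshelve. all: by end_near. Qed.

Lemma bounded_functional_submod : subsemimod_closed (bounded_functional V).
Proof.
split; first split.
- apply/bounded_functionalP; split; first by move=> a x y /=; rewrite scaler0 addr0.
  by exists 0 => x; rewrite normr0 mul0r.
- move=> f g /bounded_functionalP[lf [M fM]] /bounded_functionalP[lg [N gN]].
  apply/bounded_functionalP; split.
    by move=> a x y /=; rewrite !fctE/= lf lg scalerDr addrACA.
  exists (M + N) => x; rewrite mulrDl; apply: le_trans (ler_normD _ _) _.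
  exact: lerD.
- move=> a f /bounded_functionalP[lf [M fM]].
  apply/bounded_functionalP; split.
    move=> b x y /=; rewrite !fctE/= lf scalerDr !scalerA; congr (_ + _).
    by rewrite mulrC.
  exists (`|a| * M) => x; rewrite /= -mulrA.
  by rewrite [`|_|]normrM ler_wpM2l.
Qed.

HB.instance Definition _ := GRing.isSubmodClosed.Build R[i] (V -> R[i]^o)
  (bounded_functional V) bounded_functional_submod.

Record dual := Dual {
  dual_fun :> V -> R[i]^o ;
  dual_funP : dual_fun \in bounded_functional V }.

HB.instance Definition _ := [isSub for dual_fun].
HB.instance Definition _ := [Choice of dual by <:].
HB.instance Definition _ := [SubChoice_isSubLmodule of dual by <:].

Definition dual_norm (f : dual) : R[i] :=
  (sup [set complex.Re `|f x| | x in [set x : V | `|x| <= 1]])%:C.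

Lemma dual_linear (f : dual) : linear f.
Proof. by case: f => f /= /bounded_functionalP[]. Qed.

Lemma dual0 (f : dual) : f 0 = 0.
Proof.
have := dual_linear f (-1) 0 0; rewrite scaler0 add0r scaleN1r.
by rewrite addNr.
Qed.

Lemma dualZ (f : dual) a x : f (a *: x) = a * f x.
Proof. by rewrite -[a *: x]addr0 dual_linear dual0 addr0. Qed.

Let norm_Re (z : R[i]^o) : (complex.Re `|z|)%:C = `|z| :> R[i].
Proof. by apply: RRe_real; exact: normr_real. Qed.

Lemma dual_norm_le (f : dual) (M : R[i]) :
  0 <= M -> (forall x, `|f x| <= M * `|x|) -> dual_norm f <= M.
Proof.
move=> M0 fM; rewrite /dual_norm -(RRe_real (ger0_real M0)) lecR.
apply: ge_sup; first by exists (complex.Re `|f 0|); exists 0 => //=; rewrite normr0.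
move=> _ [x /= x1 <-]; rewrite -lecR norm_Re RRe_real ?ger0_real//.
by apply: le_trans (fM x) _; rewrite ler_piMr.
Qed.

Lemma dual_normP (f : dual) (x : V) : `|f x| <= dual_norm f * `|x|.
Proof.
have [->|x0] := eqVneq x 0; first by rewrite dual0 !normr0 mulr0.
have x_gt0 : 0 < `|x| by rewrite normr_gt0.
rewrite -ler_pdivrMr//.
have -> : `|f x| / `|x| = `|f (`|x|^-1 *: x)|.
  by rewrite dualZ [RHS]normrM ger0_norm ?invr_ge0// mulrC.
rewrite -norm_Re lecR; apply: ub_le_sup; last first.
  exists (`|x|^-1 *: x) => //=.
  by rewrite normrZ ger0_norm ?invr_ge0// mulVf ?gt_eqF.
have /bounded_functionalP[_ [M fM]] := dual_funP f.
exists (complex.Re M) => _ [y /= y1 <-].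
have M0 : 0 <= M.
  by have := le_trans (normr_ge0 _) (fM x); rewrite pmulr_lge0.
rewrite -lecR norm_Re RRe_real ?ger0_real//.
by apply: le_trans (fM y) _; rewrite ler_piMr.
Qed.

Lemma dual_norm_ge0 (f : dual) : 0 <= dual_norm f.
Proof.
rewrite /dual_norm ler0c; set E := (X in sup X).
have [[_ ubE]|/sup_out ->//] := pselect (has_sup E).
apply: ub_le_sup => //; exists 0; first by rewrite /= normr0 ler01.
by rewrite dual0 normr0.
Qed.

Lemma dual_normD (f g : dual) : dual_norm (f + g) <= dual_norm f + dual_norm g.
Proof.
apply: dual_norm_le; first by rewrite addr_ge0 ?dual_norm_ge0.
move=> x; rewrite mulrDl; apply: le_trans (ler_normD _ _) _.
by apply: lerD; exact: dual_normP.
Qed.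

Lemma dual_normZ (a : R[i]) (f : dual) : dual_norm (a *: f) = `|a| * dual_norm f.
Proof.
have le_normZ b g : dual_norm (b *: g) <= `|b| * dual_norm g.
  apply: dual_norm_le; first by rewrite mulr_ge0 ?dual_norm_ge0.
  move=> x; rewrite [leLHS]normrM -mulrA ler_wpM2l//; exact: dual_normP.
apply/eqP; rewrite eq_le le_normZ/=.
have [->|a0] := eqVneq a 0; first by rewrite normr0 mul0r dual_norm_ge0.
rewrite -ler_pdivlMl ?normr_gt0// -normfV.
by have := le_normZ a^-1 (a *: f); rewrite scalerA mulVf// scale1r.
Qed.

Lemma dual_norm_eq0 (f : dual) : dual_norm f = 0 -> f = 0.
Proof.
move=> f0; apply: val_inj; apply/funext => x /=.
by apply/eqP; rewrite -normr_le0 (le_trans (dual_normP f x))// f0 mul0r.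
Qed.

HB.instance Definition _ := Lmodule_isNormed.Build R[i] dual
  dual_normD dual_normZ dual_norm_eq0.

End dual_type.

Section bidual.
Context {R : realType} {V : normedModType R[i]}.

Lemma evaluation_bounded (x : V) :
  (fun l : dual V => l x) \in bounded_functional (dual V).
Proof.
apply/bounded_functionalP; split=> //.
by exists `|x| => l; rewrite mulrC; exact: dual_normP.
Qed.

Definition bidual_embedding (x : V) : dual (dual V) := Dual (evaluation_bounded x).

End bidual.

(* The scalar product is conjugate linear in the first variable. *)
HB.mixin Record CompleteNormedModule_isHilbert (R : realType) H
    of CompleteNormedModule R[i] H := {
  hdot : H -> H -> R[i] ;
  hdotC : forall x y, hdot y x = (hdot x y)^* ;
  hdot_linear : forall x a y z, hdot x (a *: y + z) = a * hdot x y + hdot x z ;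
  hdotxx : forall x, hdot x x = `|x| ^+ 2
}.

#[short(type="hilbertType")]
HB.structure Definition Hilbert (R : realType) :=
  {H of CompleteNormedModule R[i] H & CompleteNormedModule_isHilbert R H}.

Section riesz.
Context {R : realType} {H : hilbertType R}.
Implicit Types x y : H.

Let hdotD x y z : hdot x (y + z) = hdot x y + hdot x z.
Proof. by rewrite -[y]scale1r hdot_linear mul1r scale1r. Qed.

Let hdot0 x : hdot x 0 = 0.
Proof. by apply: (addIr (hdot x 0)); rewrite -hdotD !add0r. Qed.

Let hdotZ x a y : hdot x (a *: y) = a * hdot x y.
Proof. by rewrite -[a *: y]addr0 hdot_linear hdot0 addr0. Qed.

Lemma hdot_Cauchy_Schwarz x y : `|hdot x y| <= `|x| * `|y|.
Proof.
have [->|x0] := eqVneq x 0.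
  by rewrite hdotC hdot0 rmorph0 !normr0 mul0r.
have x_gt0 : 0 < `|x| ^+ 2 by rewrite exprn_gt0// normr_gt0.
set c := hdot x y; set u := `|x| ^+ 2 *: y - c *: x.
have hNB a v w : hdot v (`|x| ^+ 2 *: w - a *: x) = `|x| ^+ 2 * hdot v w - a * hdot v x.
  by rewrite hdotD -scaleNr !hdotZ mulNr.
have xu : hdot x u = 0 by rewrite hNB hdotxx mulrC subrr.
have yu : hdot y u = `|x| ^+ 2 * `|y| ^+ 2 - `|c| ^+ 2.
  by rewrite hNB hdotxx (hdotC x y) -normCK.
have uu : hdot u u = `|x| ^+ 2 * (hdot y u)^*.
  by rewrite {2}/u hNB (hdotC y u) (hdotC x u) xu rmorph0 mulr0 subr0.
have : 0 <= (hdot y u)^*.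
  by rewrite -(pmulr_rge0 _ x_gt0) -uu hdotxx exprn_ge0.
rewrite conjC_ge0 yu subr_ge0 -exprMn.
by rewrite ler_pXn2r// nnegrE// mulr_ge0.
Qed.

Lemma hdot_bounded (y : H) : (hdot y : H -> R[i]^o) \in bounded_functional H.
Proof.
apply/bounded_functionalP; split; first exact: hdot_linear.
by exists `|y|; exact: hdot_Cauchy_Schwarz.
Qed.

Definition riesz (y : H) : dual H := Dual (hdot_bounded y).

(* riesz is bijective by the Riesz representation theorem, so that the default
   value of xget is never used. *)
Definition riesz_inv (m : dual H) : H := xget 0 [set y | riesz y = m].

End riesz.

(* A possibly unbounded operator: only the values on dom are meaningful, and
   operators are compared with eq_operator. *)
Record operator (V W : Type) := Operator { dom : set V ; op_fun :> V -> W }.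

Section operators.
Context {R : realType} {V W : normedModType R[i]}.
Implicit Types (L M : operator V W).

Definition eq_operator L M :=
  dom L = dom M /\ forall x, dom L x -> L x = M x.

Definition op_everywhere (f : V -> W) : operator V W := Operator setT f.

Definition op_opp L : operator V W := Operator (dom L) (fun x => - L x).

Definition op_add L M : operator V W :=
  Operator (dom L `&` dom M) (fun x => L x + M x).

Definition op_inv L : operator W V :=
  Operator (L @` dom L) (fun y => xget 0 [set x | dom L x /\ L x = y]).

Definition subspace_set (D : set V) :=
  D 0 /\ forall a x y, D x -> D y -> D (a *: x + y).

Definition linear_on (D : set V) (f : V -> W) :=
  forall a x y, D x -> D y -> f (a *: x + y) = a *: f x + f y.

Definition conj_linear_on (D : set V) (f : V -> W) :=
  forall a x y, D x -> D y -> f (a *: x + y) = a^* *: f x + f y.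

Definition linear_operator L := subspace_set (dom L) /\ linear_on (dom L) L.

Definition conj_linear_operator L :=
  subspace_set (dom L) /\ conj_linear_on (dom L) L.

Definition closed_operator L :=
  closed [set p : V * W | dom L p.1 /\ L p.1 = p.2].

Definition boundedly_invertible L :=
  [/\ forall x y, dom L x -> dom L y -> L x = L y -> x = y,
      forall y, exists2 x, dom L x & L x = y
    & exists c : R[i], forall x, dom L x -> `|x| <= c * `|L x| ].

(* Banach adjoint of a densely defined linear operator. *)
Definition adjoint L : operator (dual W) (dual V) :=
  let is_adj (l : dual W) (m : dual V) :=
    forall x, dom L x -> m x = l (L x) in
  Operator [set l | exists m, is_adj l m]
           (fun l => xget 0 [set m | is_adj l m]).

(* Banach adjoint of a densely defined conjugate-linear operator. *)
Definition conj_adjoint L : operator (dual W) (dual V) :=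
  let is_adj (l : dual W) (m : dual V) :=
    forall x, dom L x -> m x = (l (L x))^* in
  Operator [set l | exists m, is_adj l m]
           (fun l => xget 0 [set m | is_adj l m]).

End operators.

Section conj_self_adjoint.
Context {R : realType} {X : normedModType R[i]}.
Implicit Type L : operator (dual X) X.

Definition conj_self_adjoint L :=
  [/\ conj_linear_operator L, dense (dom L), closed_operator L
    & eq_operator (Operator (dom L) (bidual_embedding \o L)) (conj_adjoint L)].

(* l (L l) is real when L is self-adjoint. *)
Definition gamma L : \bar R :=
  ereal_inf [set (complex.Re (l (L l)))%:E |
             l in [set l | dom L l /\ `|l| = 1]].

End conj_self_adjoint.

Section hilbert_operators.
Context {R : realType} {H : hilbertType R}.
Implicit Type A : operator H H.

Definition hilbert_adjoint A : operator H H :=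
  let is_adj (y w : H) := forall x, dom A x -> hdot w x = hdot y (A x) in
  Operator [set y | exists w, is_adj y w]
           (fun y => xget 0 [set w | is_adj y w]).

Definition self_adjoint A :=
  [/\ linear_operator A, dense (dom A) & eq_operator A (hilbert_adjoint A)].

Definition op_shift A (z : R[i]) : operator H H :=
  Operator (dom A) (fun x => - A x + z *: x).

Definition resolvent_set A : set R[i] :=
  [set z | boundedly_invertible (op_shift A z)].

Definition resolvent A (z : R[i]) : operator H H := op_inv (op_shift A z).

Definition graph_norm A (x : H) : R[i] := sqrtC (`|x| ^+ 2 + `|A x| ^+ 2).

End hilbert_operators.

(* Continuity on dom A equipped with the graph norm of A. *)
Definition graph_continuous (R : realType) (H : hilbertType R)
    (X : normedModType R[i]) (A : operator H H) (f : H -> X) :=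
  forall x, dom A x -> forall e : R[i], 0 < e ->
    exists2 d : R[i], 0 < d &
      forall y, dom A y -> graph_norm A (y - x) < d -> `|f y - f x| < e.

(* The range of tau', and the image of the dual of H, inside the dual of dom A;
   the elements of the latter are represented as functions on the type of
   elements of dom A. *)
Definition range_adjoint (R : realType) (H : hilbertType R)
    (X : normedModType R[i]) (A : operator H H) (tau : H -> X) :
    set (dom A -> R[i]) :=
  [set f | exists l : dual X, f = fun phi => l (tau (val phi))].

Definition embedded_dual (R : realType) (H : hilbertType R)
    (A : operator H H) : set (dom A -> R[i]) :=
  [set f | exists m : dual H, f = fun phi => hdot (riesz_inv m) (val phi)].

Arguments range_adjoint {R H X} A tau.
Arguments embedded_dual {R H} A.

(* (Dhat, I) is the completion of dom A for the norm x |-> `|A x|; I is only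
   meaningful on dom A. *)
Definition is_completion (R : realType) (H : hilbertType R)
    (Dhat : completeNormedModType R[i]) (A : operator H H) (I : H -> Dhat) :=
  [/\ linear_on (dom A) I, forall x, dom A x -> `|I x| = `|A x|
    & dense (I @` dom A)].

Section singular_perturbation.
Context {R : realType} {H : hilbertType R} {X Dhat : completeNormedModType R[i]}.
Variables (A : operator H H) (tau : H -> X) (I : H -> Dhat).

(* Continuous extension to Dhat of a map given on dom A (through I). *)
Definition extension (Y : normedModType R[i]) (f : H -> Y) : Dhat -> Y :=
  xget (fun=> 0) [set g | continuous g /\ forall x, dom A x -> g (I x) = f x].

Definition tau_hat : Dhat -> X := extension tau.

Definition A_hat : Dhat -> H := extension A.

Definition breveG (z : R[i]) (phi : H) : X := tau (resolvent A z phi).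

Definition G (z : R[i]) (l : dual X) : H :=
  riesz_inv (adjoint (op_everywhere (breveG z^*)) l).

Definition Rlim (phi : H) : Dhat :=
  lim (I (resolvent A ('i * eps%:C) phi) @[eps --> (0 : R)^']).

Definition K (z : R[i]) (l : dual X) : Dhat := z *: Rlim (G z l).

Definition Gamma (z : R[i]) (l : dual X) : X := tau_hat (K z l).

(* phi - G z Q = phi_reg + K z Q, where the left-hand side lies in H and the
   right-hand side in Dhat. *)
Definition decomposition (z : R[i]) (phi : H) (phi_reg : Dhat) (Q : dual X) :=
  dom A (phi - G z Q) /\ I (phi - G z Q) = phi_reg + K z Q.

Variable Theta : operator (dual X) X.

Definition admissible (z : R[i]) (phi : H) (phi_reg : Dhat) (Q : dual X) :=
  [/\ dom Theta Q, decomposition z phi phi_reg Q & tau_hat phi_reg = Theta Q].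

Definition A_Theta (z : R[i]) : operator H H :=
  Operator
    [set phi | exists phi_reg Q, admissible z phi phi_reg Q]
    (fun phi => xget 0 [set psi | exists phi_reg Q,
       admissible z phi phi_reg Q /\ psi = A_hat phi_reg]).

Definition W_plus : set R[i] :=
  [set z | exists2 lambda : R, z = lambda%:C & resolvent_set A z /\
     (gamma (op_everywhere (Gamma z)) > - gamma Theta)%E].

Definition W_minus : set R[i] :=
  [set z | exists2 lambda : R, z = lambda%:C & resolvent_set A z /\
     (gamma (op_opp (op_everywhere (Gamma z))) > - gamma (op_opp Theta))%E].

End singular_perturbation.

(* Main.v *)
Require Import Defs.
From HB Require Import structures.
From mathcomp Require Import all_boot all_order all_algebra complex.
From mathcomp Require Import all_classical all_reals ereal topology normedtype.
From mathcomp Require Import sequences ring lra.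

Import Order.TTheory GRing.Theory Num.Theory.
Import numFieldNormedType.Exports.

Local Open Scope classical_set_scope.
Local Open Scope complex_scope.
Local Open Scope ring_scope.

Set Implicit Arguments.
Unset Strict Implicit.
Unset Printing Implicit Defensive.

(** The proof rests on one observation, which removes the regularized objects.
    Since A R(z) = z R(z) - 1 and z R(z) tends strongly to 0 along the imaginary
    axis (A being injective), the extension of A to the completion of its domain
    maps the limit R phi to - phi (A_hat_spec).  This extension is moreover
    injective.  By (h3), tau = T A for a bounded operator T from H to X
    (trace_factorization).  Let T' be its adjoint, with values in H.  Then

      G(z) Q = z R(z) T' Q - T' Q   and   Gamma(z) Q = - z T G(z) Q,

    and applying A to the decomposition phi - G(z) Q = phi_reg + K(z) Q turns it
    into the condition, free of z, that phi + T' Q belongs to the domain of A and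
    A phi_reg = A (phi + T' Q) (decompositionP).  Uniqueness of Q is (h2): no
    nonzero T' Q is in the domain of A.  So the extension acts as follows:

      phi = psi - T' Q  with psi in D(A), Q in D(Theta), tau psi = Theta Q,
      A_Theta phi = A psi.

    Self-adjointness.  Symmetry is a computation.  If (y, w) is adjoint to
    A_Theta, then psi |-> <w, psi> - <y, A psi> vanishes on the kernel of tau, so it
    equals l o tau for a functional l on X, which is bounded by the open mapping
    theorem (factor_functional).  This says that y + T' l is in D(A) with
    A (y + T' l) = w, and testing against all Q in D(Theta) shows that l is in the
    domain of the adjoint of Theta, that is of Theta, with
    Theta l = tau (y + T' l).  Hence y is in the domain of A_Theta.

    Resolvent.  For h = (z - A_Theta) phi one finds phi = R(z) h + G(z) Q and
    (Theta + Gamma(z)) Q = breveG(z) h (A_Theta_shift).  When Theta + Gamma is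
    bounded below at z and at its conjugate, so is z - A_Theta; as A_Theta is
    self-adjoint, z is then in its resolvent set, and the surjectivity of
    Theta + Gamma(z) follows by solving the resolvent equation (Krein_formula).
    The lower bound comes, for real z, from the definition of gamma and, for
    nonreal z, from Im l(Gamma(z) l) = Im z |G(z) l|^2 together with the fact that
    G(z) is bounded below (Im_Gamma, G_bounded_below).

    The space X is a quotient of H by the kernel of a bounded surjection; this
    gives the separation of its points by functionals (dual_separates). *)

(** * Norms with real values *)

(** The norms of complex spaces take their values in R[i], which is only partially
    ordered; infima and linear arithmetic need the real value. *)
Definition nrm (R : realType) (V : normedZmodType R[i]) (x : V) : R :=
  complex.Re `|x|.

Section real_norm.
Context {R : realType}.

Section normed_zmodule.
Context {V : normedZmodType R[i]}.
Implicit Types x y : V.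

Lemma nrmE x : (nrm x)%:C = `|x|.
Proof. exact/RRe_real/normr_real. Qed.

Lemma nrm_ge0 x : 0 <= nrm x.
Proof. by rewrite -ler0c nrmE normr_ge0. Qed.

Lemma nrm0 : nrm (0 : V) = 0.
Proof. by rewrite /nrm normr0. Qed.

Lemma nrm0_eq0 x : nrm x = 0 -> x = 0.
Proof. by move=> x0; apply/eqP; rewrite -normr_eq0 -nrmE x0. Qed.

Lemma nrm_gt0 x : x != 0 -> 0 < nrm x.
Proof. by move=> x0; rewrite -(ltcR 0) nrmE normr_gt0. Qed.

Lemma nrmN x : nrm (- x) = nrm x.
Proof. by rewrite /nrm normrN. Qed.

Lemma nrmBC x y : nrm (x - y) = nrm (y - x).
Proof. by rewrite -nrmN opprB. Qed.

Lemma nrmD x y : nrm (x + y) <= nrm x + nrm y.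
Proof. by rewrite -lecR rmorphD/= !nrmE ler_normD. Qed.

Lemma nrmB x y : nrm (x - y) <= nrm x + nrm y.
Proof. by rewrite -(nrmN y) nrmD. Qed.

Lemma nrm_dist3 z x y : nrm (x - y) <= nrm (x - z) + nrm (z - y).
Proof. by rewrite -{1}(subrK z x) -addrA nrmD. Qed.

End normed_zmodule.

Lemma nrmM (a b : R[i]) : nrm (a * b) = nrm a * nrm b.
Proof. by apply: complexI; rewrite rmorphM/= !nrmE normrM. Qed.

Lemma nrmZ (V : normedModType R[i]) (a : R[i]) (x : V) :
  nrm (a *: x) = nrm a * nrm x.
Proof. by apply: complexI; rewrite rmorphM/= !nrmE normrZ. Qed.

Lemma nrmR (r : R) : nrm r%:C = `|r|.
Proof. by apply: complexI; rewrite nrmE normc_def/= expr0n addr0 sqrtr_sqr. Qed.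

Lemma nrm_conj (z : R[i]) : nrm (z^* : R[i]) = nrm z.
Proof. by rewrite /nrm norm_conjC. Qed.

Lemma Re_le_nrm (z : R[i]) : `|complex.Re z| <= nrm z.
Proof. by rewrite -lecR nrmE normc_ge_Re. Qed.

Lemma Im_le_nrm (z : R[i]) : `|complex.Im z| <= nrm z.
Proof.
rewrite -(normrN (complex.Im z)) -ReiNIm (le_trans (Re_le_nrm _))// nrmM.
by rewrite [X in _ * X](_ : _ = 1) ?mulr1// /nrm normc_def/= expr0n expr1n add0r sqrtr1.
Qed.

(** The order of complex numbers compares only numbers with equal imaginary
    parts, so a bound by a complex constant becomes a bound by its modulus. *)
Lemma nrm_le_mul (V W : normedZmodType R[i]) (x : V) (y : W) (c : R[i]) :
  `|x| <= c * `|y| -> nrm x <= nrm c * nrm y.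
Proof.
move=> h; have cy : c * `|y| = `|c| * `|y|.
  by rewrite -[LHS]ger0_norm ?(le_trans _ h)// normrM normr_id.
by rewrite -lecR rmorphM/= !nrmE -cy.
Qed.

Lemma norm_le_mul (V W : normedZmodType R[i]) (x : V) (y : W) (c : R) :
  nrm x <= c * nrm y -> `|x| <= c%:C * `|y|.
Proof. by move=> h; rewrite -!nrmE -rmorphM/= lecR. Qed.

Lemma inv_nat_small (C e : R) : 0 < e -> exists n : nat, C * n.+1%:R^-1 < e.
Proof.
move=> e0; exists (Num.truncn (`|C| / e)).
rewrite ltr_pdivrMr// mulrC -ltr_pdivrMr//.
apply: le_lt_trans (truncnS_gt _).
by rewrite ler_pM2r ?invr_gt0// ler_norm.
Qed.

Section topology.
Context {V : normedModType R[i]}.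

Lemma nbhs_nrmP (x : V) (B : set V) :
  nbhs x B <-> exists2 e : R, 0 < e & forall y, nrm (x - y) < e -> B y.
Proof.
split=> [/nbhs_normP[e /= e0 eB]|[e e0 eB]].
  exists (complex.Re e).
    by move: e0; rewrite ltcE => /andP[_].
  move=> y xy; apply: eB => /=.
  by rewrite -nrmE -[e](RRe_real (gtr0_real e0)) ltcR.
apply/nbhs_normP; exists e%:C; first by rewrite /= ltcR.
by move=> y /=; rewrite -nrmE ltcR => /eB.
Qed.

Lemma dense_nrmP (D : set V) :
  dense D <-> forall x (e : R), 0 < e -> exists2 y, D y & nrm (x - y) < e.
Proof.
split=> [dD x e e0|dD O [x Ox] oO].
  have nx : nbhs x [set y | nrm (x - y) < e] by apply/nbhs_nrmP; exists e.
  have [|y [yO Dy]] := dD _ _ (open_interior [set y | nrm (x - y) < e]).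
    by exists x; exact: nx.
  by exists y => //; exact: (interior_subset yO).
have /nbhs_nrmP[e e0 eO] : nbhs x O by exact: open_nbhs_nbhs.
by have [y Dy xy] := dD x e e0; exists y; split => //; exact: eO.
Qed.

Lemma nrm_small_eq0 (x : V) : (forall e : R, 0 < e -> nrm x <= e) -> x = 0.
Proof.
move=> h; apply: nrm0_eq0; apply/eqP; rewrite eq_le nrm_ge0 andbT.
by apply/ler_addgt0Pl => e /h; rewrite addr0.
Qed.

End topology.

Section maps.
Context {V : normedModType R[i]}.

Lemma lipschitz_continuous (W : normedModType R[i]) (f : V -> W) (c : R) :
  (forall x y, nrm (f x - f y) <= c * nrm (x - y)) -> continuous f.
Proof.
move=> fc x B /nbhs_nrmP[e e0 eB]; apply/nbhs_nrmP.
have c0 : 0 < `|c| + 1 by rewrite ltr_wpDl.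
exists (e / (`|c| + 1)); first by rewrite divr_gt0.
move=> y; rewrite ltr_pdivlMr// => xy; apply: eB; apply: le_lt_trans (fc _ _) _.
apply: le_lt_trans xy; rewrite mulrC ler_wpM2l ?nrm_ge0//.
by rewrite (le_trans (ler_norm _))// lerDl.
Qed.

Lemma continuous_dense_eq (W : normedModType R[i]) (f g : V -> W) (D : set V) :
  continuous f -> continuous g -> dense D -> (forall x, D x -> f x = g x) ->
  f = g.
Proof.
move=> cf cg dD fg; apply/funext => x; apply/eqP; rewrite -subr_eq0; apply/eqP.
apply: nrm_small_eq0 => e e0.
have e20 : 0 < e / 2 by rewrite divr_gt0.
have [d1 d10 fd] : exists2 d : R, 0 < d & forall y, nrm (x - y) < d ->
    nrm (f x - f y) < e / 2.
  have /nbhs_nrmP : nbhs x (f @^-1` [set w | nrm (f x - w) < e / 2]).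
    by apply: cf; apply/nbhs_nrmP; exists (e / 2).
  by move=> [d d0 h]; exists d.
have [d2 d20 gd] : exists2 d : R, 0 < d & forall y, nrm (x - y) < d ->
    nrm (g x - g y) < e / 2.
  have /nbhs_nrmP : nbhs x (g @^-1` [set w | nrm (g x - w) < e / 2]).
    by apply: cg; apply/nbhs_nrmP; exists (e / 2).
  by move=> [d d0 h]; exists d.
have m0 : 0 < Num.min d1 d2 by rewrite lt_min d10.
have [y Dy] := (dense_nrmP D).1 dD x _ m0.
rewrite lt_min => /andP[/fd fy /gd gy].
rewrite (fg y Dy) in fy; have := nrm_dist3 (g y) (f x) (g x).
rewrite (nrmBC (g y)); move: fy gy; lra.
Qed.

End maps.

(** The Cauchy sequences below come with an explicit modulus of convergence; that
    the limit inherits it makes epsilon arguments about the limit immediate. *)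
Lemma complete_seq (V : completeNormedModType R[i]) (u : nat -> V) (b : nat -> R) :
  (forall e : R, 0 < e -> exists n, b n < e) ->
  (forall n m, (n <= m)%N -> nrm (u m - u n) <= b n) ->
  exists l, forall n, nrm (l - u n) <= b n.
Proof.
move=> b0 ub.
have cu : cauchy (u @ \oo).
  apply: cauchy_exP => e e0.
  have [|n bn] := b0 (complex.Re e).
    by move: e0; rewrite ltcE => /andP[_].
  exists (u n), n => // m /= nm.
  rewrite -ball_normE /=.
  by rewrite -nrmE -[e](RRe_real (gtr0_real e0)) ltcR nrmBC (le_lt_trans (ub _ _ nm)).
have /cvg_ex[l ul] : cvg (u @ \oo) by exact: cauchy_cvg.
exists l => n; apply/ler_addgt0Pl => e e0.
have : \forall m \near \oo, nrm (l - u m) < e.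
  by apply: (ul [set y | nrm (l - y) < e]); apply/nbhs_nrmP; exists e.
move=> [N _ hN]; have := hN (maxn N n) (leq_maxl _ _).
have := ub n (maxn N n) (leq_maxr _ _).
have := nrm_dist3 (u (maxn N n)) l (u n).
by move=> /= *; lra.
Qed.

End real_norm.

(** * Geometry of Hilbert spaces *)

Section scalar_product.
Context {R : realType} {H : hilbertType R}.
Implicit Types x y z : H.

Lemma hdotDr x y z : hdot x (y + z) = hdot x y + hdot x z.
Proof. by rewrite -[y]scale1r hdot_linear mul1r scale1r. Qed.

Lemma hdot0r x : hdot x 0 = 0.
Proof. by apply: (addIr (hdot x 0)); rewrite -hdotDr !add0r. Qed.

Lemma hdotZr x a y : hdot x (a *: y) = a * hdot x y.
Proof. by rewrite -[a *: y]addr0 hdot_linear hdot0r addr0. Qed.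

Lemma hdotNr x y : hdot x (- y) = - hdot x y.
Proof. by rewrite -scaleN1r hdotZr mulN1r. Qed.

Lemma hdotBr x y z : hdot x (y - z) = hdot x y - hdot x z.
Proof. by rewrite hdotDr hdotNr. Qed.

Lemma hdotDl x y z : hdot (x + y) z = hdot x z + hdot y z.
Proof. by rewrite hdotC hdotDr rmorphD/= -!hdotC. Qed.

Lemma hdotZl x a y : hdot (a *: x) y = a^* * hdot x y.
Proof. by rewrite hdotC hdotZr rmorphM/= -hdotC. Qed.

Lemma hdotNl x y : hdot (- x) y = - hdot x y.
Proof. by rewrite hdotC hdotNr rmorphN/= -hdotC. Qed.

Lemma hdotBl x y z : hdot (x - y) z = hdot x z - hdot y z.
Proof. by rewrite hdotDl hdotNl. Qed.

Lemma hdot0l x : hdot 0 x = 0.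
Proof. by rewrite hdotC hdot0r rmorph0. Qed.

Lemma hdot_nrm x : hdot x x = (nrm x ^+ 2)%:C.
Proof. by rewrite hdotxx -nrmE rmorphXn. Qed.

Lemma nrm_hdot x y : nrm (hdot x y) <= nrm x * nrm y.
Proof. by rewrite -lecR rmorphM/= !nrmE hdot_Cauchy_Schwarz. Qed.

Lemma nrm_sqrD x y :
  nrm (x + y) ^+ 2 = nrm x ^+ 2 + nrm y ^+ 2 + complex.Re (hdot x y) *+ 2.
Proof.
have -> : nrm (x + y) ^+ 2 = complex.Re (hdot (x + y) (x + y)).
  by rewrite hdot_nrm.
rewrite hdotDl !hdotDr (hdotC x y) !hdot_nrm.
by case: (hdot x y) => a b /=; rewrite mulr2n; ring.
Qed.

Lemma hdot_dense_eq0 (D : set H) x :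
  dense D -> (forall y, D y -> hdot x y = 0) -> x = 0.
Proof.
move=> /dense_nrmP dD xD; apply: nrm_small_eq0 => e e0.
have [->|x0] := eqVneq x 0; first by rewrite nrm0 ltW.
have [y Dy xy] := dD x e e0.
have : nrm x ^+ 2 = nrm (hdot x (x - y)).
  by rewrite hdotBr (xD y Dy) subr0 hdot_nrm nrmR ger0_norm ?sqr_ge0.
move=> xx; have := nrm_hdot x (x - y); rewrite -xx expr2 ler_pM2l ?nrm_gt0//.
by move=> /le_trans; apply; exact: ltW.
Qed.

Lemma hdot_eq0 x : (forall y, hdot x y = 0) -> x = 0.
Proof.
move=> x0; apply: (@hdot_dense_eq0 setT) => //.
by apply/dense_nrmP => y e e0; exists y; rewrite ?subrr ?nrm0.
Qed.

Lemma hdot_inj x y : (forall z, hdot x z = hdot y z) -> x = y.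
Proof.
move=> xy; apply/eqP; rewrite -subr_eq0; apply/eqP/hdot_eq0 => z.
by rewrite hdotBl xy subrr.
Qed.

(** Subtracting from p its orthogonal projection on m shortens p unless the two
    are orthogonal. *)
Lemma min_orthogonal p (m : H) :
  (forall a : R[i], nrm p <= nrm (p - a *: m)) -> hdot p m = 0.
Proof.
move=> pm; have [->|m0] := eqVneq m 0; first by rewrite hdot0r.
have m2 : 0 < nrm m ^+ 2 by rewrite exprn_gt0// nrm_gt0.
(* This multiple of m is the orthogonal projection of p on m. *)
have := pm ((nrm m ^+ 2)^-1%:C * hdot m p).
rewrite -(@ler_pXn2r _ 2) ?nnegrE ?nrm_ge0// -scaleNr nrm_sqrD.
rewrite nrmZ nrmN nrmM nrmR hdotZr (hdotC p m) nrm_conj.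
move: (hdot p m) => w;  rewrite ger0_norm ?invr_ge0 ?sqr_ge0//.
rewrite -addrA lerDl => h.
have : nrm w ^+ 2 <= 0.
  have nw : (nrm w ^+ 2)%:C = w * w^*.
    by rewrite -normCK -nrmE rmorphXn.
  move: h.
  rewrite (_ : complex.Re _ = - ((nrm m ^+ 2)^-1 * nrm w ^+ 2)); last first.
  by rewrite mulNr -mulrA (mulrC _^*) -nw -rmorphM raddfN.
  rewrite !exprMn mulrAC; set M := nrm m ^+ 2 in m2 *.
  rewrite (_ : M^-1 ^+ 2 * M = M^-1); last by rewrite expr2 -mulrA mulVf ?mulr1 ?gt_eqF.
  have Mi : 0 < M^-1 by rewrite invr_gt0.
  have := sqr_ge0 (nrm w); nra.
move=> w0; apply: nrm0_eq0; apply/eqP; rewrite -sqrf_eq0 eq_le w0 sqr_ge0//.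
Qed.

(** A sequence of M that minimizes the distance to h is Cauchy by the
    parallelogram identity; p is the difference of h and its limit, so h - p lies
    in the closure of M. *)
Lemma orthogonal_projection (M : set H) (h : H) : subspace_set M ->
  exists p : H, (forall m, M m -> hdot p m = 0) /\
    forall e : R, 0 < e -> exists2 m, M m & nrm (h - p - m) < e.
Proof.
move=> [M0 Ml].
pose E := [set nrm (h - m) ^+ 2 | m in M].
have hE : has_inf E.
  split; first by exists (nrm (h - 0) ^+ 2), 0.
  by exists 0 => _ [m _ <-]; exact: sqr_ge0.
pose d := inf E.
have dE m : M m -> d <= nrm (h - m) ^+ 2.
  by move=> Mm; apply: ge_inf => //; [case: hE|exists m].
(* A squared slack n^-2 makes the distances between the u n of order n^-1. *)
have /choice[u Mu] : forall n : nat, exists x,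
    M x /\ nrm (h - x) ^+ 2 < d + n.+1%:R^-1 ^+ 2.
  move=> n; have [|_ [m Mm <-] hm] := @inf_adherent _ E (n.+1%:R^-1 ^+ 2) _ hE.
    by rewrite exprn_gt0// invr_gt0.
  by exists m.
have MB a x y : M x -> M y -> M (y - a *: x).
  by move=> Mx My; rewrite -scaleNr addrC; exact: Ml.
have uu n m : (n <= m)%N -> nrm (u m - u n) <= 2 * n.+1%:R^-1.
  move=> nm; have [Mn hn] := Mu n; have [Mm hm] := Mu m.
  have Mmid : M (2^-1 *: (u n + u m)).
    rewrite -[_ *: _]addr0; apply: (Ml) => //.
    by rewrite -[u n]scale1r; exact: Ml.
  have := dE _ Mmid.
  have mn : (m.+1%:R^-1 : R) <= n.+1%:R^-1 by rewrite lef_pV2 ?posrE// ler_nat.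
  have mn2 : (m.+1%:R^-1 : R) ^+ 2 <= n.+1%:R^-1 ^+ 2.
    by rewrite ler_pXn2r ?nnegrE ?invr_ge0.
  have sumE : h - 2^-1 *: (u n + u m) = 2^-1 *: ((h - u n) + (h - u m)).
    rewrite addrACA -opprD scalerBr; congr (_ - _).
    by rewrite -(mulr2n h) -(scaler_nat 2 h) scalerA mulVf ?scale1r ?pnatr_eq0.
  have diffE : u m - u n = (h - u n) - (h - u m).
    by rewrite opprB [RHS]addrC addrA subrK.
  rewrite sumE nrmZ exprMn.
  have -> : nrm (2^-1 : R[i]) ^+ 2 = 4^-1.
    rewrite (_ : (2^-1 : R[i]) = (2^-1)%:C); last by rewrite fmorphV rmorph_nat.
    by rewrite nrmR ger0_norm ?invr_ge0// expr2 -invfM -natrM.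
  rewrite nrm_sqrD => hd.
  rewrite -(@ler_pXn2r _ 2) ?nnegrE ?nrm_ge0//.
  rewrite diffE nrm_sqrD nrmN hdotNr raddfN/= exprMn mulNrn.
  move: hd hn hm mn2; rewrite !(mulr2n (complex.Re _)).
  move: (n.+1%:R^-1 ^+ 2) (m.+1%:R^-1 ^+ 2) (nrm (h - u n) ^+ 2) => rn rm x.
  move: (nrm (h - u m) ^+ 2) (complex.Re _) => y c; lra.
have [e e0|l ul] := complete_seq _ uu; first exact: inv_nat_small.
exists (h - l); split; last first.
  move=> e e0; have [n hn] := inv_nat_small 2 e0.
  by exists (u n); [case: (Mu n)|rewrite subKr (le_lt_trans (ul n))].
have d0 : 0 <= d by apply: lb_le_inf => [|_ [m _ <-]]; [case: hE|exact: sqr_ge0].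
pose q := Num.sqrt d; have q0 : 0 <= q by exact: sqrtr_ge0.
have qq : q ^+ 2 = d by exact: sqr_sqrtr.
move=> m Mm; apply: min_orthogonal => a; apply/ler_addgt0Pl => e e0.
have [n] := inv_nat_small 5 e0; have := ul n; have [Mn] := Mu n.
set r := n.+1%:R^-1; have r0 : 0 < r by rewrite invr_gt0.
move=> hn lr re.
have qm : q <= nrm (h - (u n + a *: m)).
  rewrite -(@ler_pXn2r _ 2) ?nnegrE ?nrm_ge0// qq; apply: dE.
  by rewrite addrC; exact: Ml.
have hq : nrm (h - u n) <= q + r.
  rewrite -(@ler_pXn2r _ 2) ?nnegrE ?nrm_ge0 ?addr_ge0//; last exact: ltW.
  by rewrite (le_trans (ltW hn))// -qq sqrrD lerD2r lerDl mulrn_wge0// mulr_ge0// ltW.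
have := nrm_dist3 (u n) h l; rewrite (nrmBC (u n)).
have := nrmD (h - l - a *: m) (l - u n).
rewrite (_ : h - l - a *: m + (l - u n) = h - (u n + a *: m)); last first.
  by rewrite addrAC (addrA (h - l)) subrK opprD addrA.
by move=> *; lra.
Qed.

End scalar_product.

(** * Dual spaces and the Riesz representation *)

Section dual_space.
Context {R : realType} {V : normedModType R[i]}.
Implicit Types (l m : dual V) (x y : V).

Lemma dual_ext l m : (forall x, l x = m x) -> l = m.
Proof. by move=> lm; apply: val_inj; apply/funext. Qed.

Lemma dualDr l x y : l (x + y) = l x + l y.
Proof. by rewrite -[x]scale1r dual_linear !scale1r. Qed.

Lemma dualNr l x : l (- x) = - l x.
Proof. by rewrite -scaleN1r dualZ mulN1r. Qed.

Lemma dualBr l x y : l (x - y) = l x - l y.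
Proof. by rewrite dualDr dualNr. Qed.

Lemma dualDl l m x : (l + m) x = l x + m x.
Proof. by []. Qed.

Lemma dualZl a l x : (a *: l) x = a * l x.
Proof. by []. Qed.

Lemma dualBl l m x : (l - m) x = l x - m x.
Proof. by rewrite -scaleN1r dualDl dualZl mulN1r. Qed.

Lemma dual0l x : (0 : dual V) x = 0.
Proof. by []. Qed.

Lemma nrm_dual l x : nrm (l x : R[i]) <= nrm l * nrm x.
Proof. by rewrite -lecR rmorphM/= !nrmE dual_normP. Qed.

Lemma nrm_dual_le l (M : R) : 0 <= M ->
  (forall x, nrm (l x : R[i]) <= M * nrm x) -> nrm l <= M.
Proof.
move=> M0 lM; rewrite -lecR nrmE; apply: dual_norm_le; first by rewrite lecR.
by move=> x; exact: norm_le_mul (lM x).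
Qed.

Lemma bounded_dual (f : V -> R[i]) (M : R) : linear (f : V -> R[i]^o) ->
  (forall x, nrm (f x) <= M * nrm x) -> exists l : dual V, forall x, l x = f x.
Proof.
move=> lf fM; suff bf : (f : V -> R[i]^o) \in bounded_functional V.
  by exists (Dual bf).
by apply/bounded_functionalP; split=> //; exists M%:C => x; exact: norm_le_mul.
Qed.

End dual_space.

Section riesz_representation.
Context {R : realType} {H : hilbertType R}.
Implicit Types x y : H.

Lemma dense_orthogonal (M : set H) : subspace_set M ->
  (forall w, (forall m, M m -> hdot w m = 0) -> w = 0) -> dense M.
Proof.
move=> sM M0; apply/dense_nrmP => x e e0.
have [p [pM px]] := orthogonal_projection x sM.
by have [m Mm xm] := px e e0; exists m => //; rewrite (M0 p pM) subr0 in xm.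
Qed.

(** A nonzero functional m is a multiple of the scalar product with any nonzero
    vector orthogonal to its kernel. *)
Lemma riesz_surj (m : dual H) : exists y, riesz y = m.
Proof.
have [[h mh]|m0] := pselect (exists h, m h != 0); last first.
  exists 0; apply: dual_ext => x /=; rewrite hdot0l; apply/eqP.
  by rewrite eq_sym; apply: contra_notT m0 => mx; exists x.
have kerS : subspace_set [set x | m x = 0].
  split=> [|a x y /= mx my]; first exact: dual0.
  by rewrite dual_linear mx my scaler0 addr0.
have [p [pM ph]] := orthogonal_projection h kerS.
have mp : m p = m h.
  apply/esym/eqP; rewrite -subr_eq0 -dualBr; apply/eqP.
  apply: (@nrm_small_eq0 _ R[i]^o) => e e0.
  have c0 : 0 < nrm m + 1 by rewrite ltr_wpDl ?nrm_ge0.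
  have [x mx hx] := ph _ (divr_gt0 e0 c0).
  have -> : m (h - p) = m (h - p - x) by rewrite (dualBr m (h - p)) (mx : m x = 0) subr0.
  apply: le_trans (nrm_dual _ _) _; rewrite ltr_pdivlMr// in hx.
  rewrite (le_trans _ (ltW hx))// mulrC ler_wpM2l ?nrm_ge0// lerDl//.
have p0 : p != 0 by apply: contraNneq mh => p0; rewrite -mp p0 dual0.
have pp : hdot p p != 0.
  by rewrite hdotxx expf_eq0/= normr_eq0.
exists ((m h / hdot p p)^* *: p); apply: dual_ext => x /=.
rewrite hdotZl conjCK.
have : hdot p (x - (m x / m h) *: p) = 0.
  by apply: pM; rewrite /= dualBr dualZ mp divfK// subrr.
rewrite hdotBr hdotZr => /eqP; rewrite subr_eq0 => /eqP ->.
by rewrite [LHS]mulrC -mulrA (mulrC (hdot p p)) divfK// divfK.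
Qed.

Lemma riesz_invE (m : dual H) x : hdot (riesz_inv m) x = m x.
Proof.
have [y ym] := riesz_surj m.
suff : riesz (riesz_inv m) = m by move=> /(congr1 (fun l : dual H => l x)).
by have := @xgetPex _ 0 [set y | riesz y = m] (ex_intro _ y ym).
Qed.

End riesz_representation.

(** * Linear maps on subspaces and bounded inverses *)

Section subspaces.
Context {R : realType} {V W : normedModType R[i]}.

Section subspace.
Variable D : set V.
Hypothesis sD : subspace_set D.

Lemma subspace0 : D 0. Proof. by case: sD. Qed.

Lemma subspaceZ a x : D x -> D (a *: x).
Proof. by case: sD => D0 Dl Dx; rewrite -[_ *: _]addr0; exact: Dl. Qed.

Lemma subspaceD x y : D x -> D y -> D (x + y).
Proof. by case: sD => D0 Dl Dx Dy; rewrite -[x]scale1r; exact: Dl. Qed.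

Lemma subspaceN x : D x -> D (- x).
Proof. by move=> Dx; rewrite -scaleN1r; exact: subspaceZ. Qed.

Lemma subspaceB x y : D x -> D y -> D (x - y).
Proof. by move=> Dx Dy; apply: subspaceD => //; exact: subspaceN. Qed.

Section linear_map.
Variable f : V -> W.
Hypothesis lf : linear_on D f.

Lemma linear_onD x y : D x -> D y -> f (x + y) = f x + f y.
Proof. by move=> Dx Dy; rewrite -[x]scale1r lf// !scale1r. Qed.

Lemma linear_on0 : f 0 = 0.
Proof.
apply: (addIr (f 0)); rewrite -linear_onD; try exact: subspace0.
by rewrite !add0r.
Qed.

Lemma linear_onZ a x : D x -> f (a *: x) = a *: f x.
Proof.
move=> Dx; rewrite -[a *: x]addr0 lf//; last exact: subspace0.
by rewrite linear_on0 addr0.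
Qed.

Lemma linear_onB x y : D x -> D y -> f (x - y) = f x - f y.
Proof.
move=> Dx Dy; rewrite linear_onD//; last exact: subspaceN.
by rewrite -scaleN1r linear_onZ// scaleN1r.
Qed.

End linear_map.
End subspace.

Section linear_function.
Variable f : V -> W.
Hypothesis lf : forall a x y, f (a *: x + y) = a *: f x + f y.

Let lfT : linear_on setT f. Proof. by move=> a x y _ _; exact: lf. Qed.
Let subspaceT : subspace_set (@setT V). Proof. by []. Qed.

Lemma linear_fun0 : f 0 = 0.
Proof. exact: linear_on0 subspaceT _ lfT. Qed.

Lemma linear_funD x y : f (x + y) = f x + f y.
Proof. exact: linear_onD lfT _ _ Logic.I Logic.I. Qed.

Lemma linear_funZ a x : f (a *: x) = a *: f x.
Proof. exact: (linear_onZ subspaceT lfT a Logic.I). Qed.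

Lemma linear_funN x : f (- x) = - f x.
Proof. by rewrite -scaleN1r linear_funZ scaleN1r. Qed.

Lemma linear_funB x y : f (x - y) = f x - f y.
Proof. by rewrite linear_funD linear_funN. Qed.

End linear_function.
End subspaces.

Section bounded_inverse.
Context {R : realType} {V W : normedModType R[i]}.
Variable L : operator V W.
Hypothesis bL : boundedly_invertible L.

Lemma op_invP y : dom L (op_inv L y) /\ L (op_inv L y) = y.
Proof.
have [_ /(_ y)[x Dx xy] _] := bL.
exact: (@xgetPex _ 0 [set x | dom L x /\ L x = y] (ex_intro _ x (conj Dx xy))).
Qed.

Lemma op_inv_uniq x y : dom L x -> L x = y -> op_inv L y = x.
Proof.
move=> Dx xy; have [Di Li] := op_invP y.
by have [inj _ _] := bL; apply: inj; rewrite // Li.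
Qed.

Lemma op_inv_bound : exists2 c : R, 0 <= c &
  forall y, nrm (op_inv L y) <= c * nrm y.
Proof.
have [_ _ [c cL]] := bL; exists (nrm c); first exact: nrm_ge0.
move=> y; have [Di Li] := op_invP y.
by have /nrm_le_mul := cL _ Di; rewrite Li.
Qed.

End bounded_inverse.

Lemma boundedly_invertible_intro (R : realType) (V W : normedModType R[i])
    (L : operator V W) (c : R) :
  (forall x y, dom L x -> dom L y -> dom L (x - y) /\ L (x - y) = L x - L y) ->
  (forall x, dom L x -> nrm x <= c * nrm (L x)) ->
  (forall y, exists2 x, dom L x & L x = y) -> boundedly_invertible L.
Proof.
move=> LB cL surj; split=> //.
- move=> x y Dx Dy xy; have [DB LE] := LB x y Dx Dy.
  apply/eqP; rewrite -subr_eq0; apply/eqP/nrm_small_eq0 => e e0.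
  by rewrite (le_trans (cL _ DB))// LE xy subrr nrm0 mulr0 ltW.
- by exists c%:C => x Dx; apply: norm_le_mul; exact: cL.
Qed.

(** * Self-adjoint operators *)

Section self_adjoint_operators.
Context {R : realType} {H : hilbertType R}.
Implicit Types (S : operator H H) (x y w : H) (z : R[i]).

Lemma self_adjoint_sym S x y : self_adjoint S -> dom S x -> dom S y ->
  hdot x (S y) = hdot (S x) y.
Proof.
move=> [_ _ [DS vS]] Dx Dy; have Dx' := Dx; rewrite DS in Dx'.
by rewrite (vS x Dx); have /= := xgetPex 0 Dx' => ->.
Qed.

(** Since the domain is dense, the value of the adjoint at y can only be w. *)
Lemma self_adjoint_max S y w : self_adjoint S ->
  (forall x, dom S x -> hdot w x = hdot y (S x)) -> dom S y /\ S y = w.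
Proof.
move=> [lS dS [DS vS]] yw.
have Dy : dom (hilbert_adjoint S) y by exists w.
have Dy' : dom S y by rewrite DS.
split => //; rewrite (vS y Dy'); apply/eqP; rewrite -subr_eq0; apply/eqP.
apply: (hdot_dense_eq0 dS) => x Dx; rewrite hdotBl yw//.
by have /= -> := xgetPex 0 Dy => //; rewrite subrr.
Qed.

(** A symmetric operator that contains all pairs adjoint to it is self-adjoint;
    density of the domain is automatic, since a vector w orthogonal to the domain
    makes (0, w) adjoint to the operator. *)
Lemma self_adjoint_intro S : linear_operator S ->
  (forall x y, dom S x -> dom S y -> hdot x (S y) = hdot (S x) y) ->
  (forall y w, (forall x, dom S x -> hdot w x = hdot y (S x)) ->
     dom S y /\ S y = w) ->
  self_adjoint S.
Proof.
move=> [sS lS] symS maxS; split=> //.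
  apply: dense_orthogonal => // w wD.
  have [|_ <-] := maxS 0 w; last exact: linear_on0 sS _ lS.
  by move=> x Dx; rewrite wD// hdot0l.
have DE : dom S = dom (hilbert_adjoint S).
  apply/seteqP; split => y /=.
    by move=> Dy; exists (S y) => x Dx; rewrite symS.
  by move=> [w /maxS[]].
split=> // y Dy; rewrite DE in Dy.
by have /maxS[] := xgetPex 0 Dy.
Qed.

Lemma op_shiftB S z x y : linear_operator S -> dom S x -> dom S y ->
  op_shift S z (x - y) = op_shift S z x - op_shift S z y.
Proof.
by move=> [sS lS] Dx Dy /=; rewrite (linear_onB sS lS)// scalerBr !opprD !opprK addrACA.
Qed.

(** The range of a self-adjoint operator minus z is closed when S - z is bounded
    below, because the operator is closed; the orthogonal complement of the range
    is the kernel of S minus the conjugate of z, trivial by the second bound. *)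
Lemma bounded_below_resolvent S z (c c' : R) : self_adjoint S ->
  (forall x, dom S x -> nrm x <= c * nrm (- S x + z *: x)) ->
  (forall x, dom S x -> nrm x <= c' * nrm (- S x + z^* *: x)) ->
  resolvent_set S z.
Proof.
move=> saS cz cz'; have [lS dS _] := saS; have [sS linS] := lS.
apply: (@boundedly_invertible_intro _ _ _ _ c) => //.
  by move=> x y Dx Dy; split; [exact: subspaceB|exact: op_shiftB].
move=> y; pose M := [set w | exists2 x, dom S x & op_shift S z x = w].
have sM : subspace_set M.
  split.
    exists 0; first exact: subspace0.
    by rewrite /= (linear_on0 sS linS) scaler0 oppr0 addr0.
  move=> a _ _ [u Du <-] [v Dv <-]; exists (a *: u + v).
    by apply: subspaceD => //; exact: subspaceZ.
  by rewrite /= linS// scalerDr opprD addrACA !scalerA scalerDr scalerN mulrC scalerA.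
have MT w : (forall m, M m -> hdot w m = 0) -> w = 0.
  move=> wM; have [|Dw Sw] := @self_adjoint_max S w (z^* *: w) saS.
    move=> x Dx; have := wM _ (ex_intro2 _ _ x Dx erefl).
    rewrite /= hdotDr hdotNr hdotZr hdotZl conjCK => /eqP.
    by rewrite addrC subr_eq0 => /eqP.
  apply: nrm_small_eq0 => e e0.
  by rewrite (le_trans (cz' _ Dw))// Sw addNr nrm0 mulr0 ltW.
(* Approximate preimages of y form a Cauchy sequence, and its limit is a preimage. *)
have /dense_nrmP dM := dense_orthogonal sM MT.
have /choice[u Du] : forall n : nat, exists x, dom S x /\
    nrm (y - op_shift S z x) < n.+1%:R^-1.
  move=> n; have [|_ [x Dx <-] yx] := dM y (n.+1%:R^-1); first by rewrite invr_gt0.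
  by exists x.
have uu n m : (n <= m)%N -> nrm (u m - u n) <= (`|c| * 2) * n.+1%:R^-1.
  move=> nm; have [Dn yn] := Du n; have [Dm ym] := Du m.
  apply: le_trans (cz _ (subspaceB sS Dm Dn)) _.
  apply: le_trans (ler_wpM2r (nrm_ge0 _) (ler_norm c)) _.
  rewrite -mulrA ler_wpM2l//.
  have := op_shiftB z lS Dm Dn; rewrite /= => ->.
  have mn : (m.+1%:R^-1 : R) <= n.+1%:R^-1 by rewrite lef_pV2 ?posrE// ler_nat.
  have := nrm_dist3 y (op_shift S z (u m)) (op_shift S z (u n)).
  rewrite nrmBC in ym; rewrite /= in ym yn *; move: mn ym yn.
  by move: n.+1%:R^-1 m.+1%:R^-1 => rn rm; lra.
have [e e0|x ux] := complete_seq _ uu; first exact: inv_nat_small.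
(* S is closed: the relation that defines the adjoint passes to the limit. *)
have [|Dx Sx] := @self_adjoint_max S x (z *: x - y) saS.
  move=> v Dv; apply/eqP; rewrite -subr_eq0; apply/eqP.
  apply: (@nrm_small_eq0 _ R[i]^o) => e e0.
  pose C := nrm z * nrm v * (`|c| * 2) + nrm v + nrm (S v) * (`|c| * 2).
  have [n hn] := inv_nat_small C e0.
  have [Dn yn] := Du n; have := ux n; set r := n.+1%:R^-1 in hn yn * => xn.
  have -> : hdot (z *: x - y) v - hdot x (S v) =
      hdot (z *: (x - u n)) v - hdot (y - op_shift S z (u n)) v - hdot (x - u n) (S v).
    rewrite /= !hdotBl scalerBr !hdotBl hdotDl hdotNl (self_adjoint_sym saS Dn Dv).
    ring.
  apply: le_trans (ltW hn); rewrite /C.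
  apply: le_trans (nrmB _ _) _; rewrite [X in _ <= X]mulrDl; apply: lerD.
    apply: le_trans (nrmB _ _) _; rewrite [X in _ <= X]mulrDl; apply: lerD.
      apply: le_trans (nrm_hdot _ _) _; rewrite nrmZ.
      by rewrite mulrAC -[leRHS]mulrA ler_wpM2l ?mulr_ge0 ?nrm_ge0.
    apply: le_trans (nrm_hdot _ _) _; rewrite mulrC ler_wpM2l ?nrm_ge0//.
    exact: ltW.
  by apply: le_trans (nrm_hdot _ _) _; rewrite mulrC -[leRHS]mulrA ler_wpM2l ?nrm_ge0.
by exists x => //=; rewrite Sx opprB subrK.
Qed.

(** The scalar product <x, S x> is real, so Im <x, (z - S) x> = Im z |x|^2. *)
Lemma nonreal_bound S z x : self_adjoint S -> dom S x ->
  `|complex.Im z| * nrm x <= nrm (- S x + z *: x).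
Proof.
move=> saS Dx; have [->|x0] := eqVneq x 0; first by rewrite nrm0 mulr0 nrm_ge0.
rewrite -(@ler_pM2l _ (nrm x)) ?nrm_gt0//.
apply: le_trans (nrm_hdot x (- S x + z *: x)).
apply: le_trans (Im_le_nrm _).
have : complex.Im (hdot x (S x)) = 0.
  have := hdotC x (S x); rewrite -(self_adjoint_sym saS Dx Dx).
  case: (hdot x (S x)) => a b [] /=; lra.
rewrite hdotDr hdotNr hdotZr hdot_nrm; case: (hdot x (S x)) => a b /= b0.
case: z => u v /=; rewrite b0 mulr0 oppr0 !add0r normrM [`|_ ^+ 2|]ger0_norm ?sqr_ge0//.
by rewrite mulrCA -expr2.
Qed.

Lemma nonreal_resolvent S z : self_adjoint S -> complex.Im z != 0 ->
  resolvent_set S z.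
Proof.
move=> saS z0; apply: (@bounded_below_resolvent _ _ `|complex.Im z|^-1 `|complex.Im z|^-1) => //.
  by move=> x Dx; rewrite ler_pdivlMl ?normr_gt0//; exact: nonreal_bound.
move=> x Dx; rewrite ler_pdivlMl ?normr_gt0//.
rewrite (_ : `|complex.Im z| = `|complex.Im (z^*)|); first exact: nonreal_bound.
by case: (z) => a b /=; rewrite normrN.
Qed.

Lemma resolvent_set_conj S z : self_adjoint S -> resolvent_set S z ->
  resolvent_set S z^*.
Proof.
move=> saS zS; have [z0|z0] := eqVneq (complex.Im z) 0.
  suff -> : z^* = z by [].
  by case: z z0 {zS} => a b /= ->; rewrite /Num.conj /= oppr0.
apply: nonreal_resolvent => //; apply: contraNneq z0.
by case: (z) => a b /= /eqP; rewrite oppr_eq0 => /eqP ->.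
Qed.

End self_adjoint_operators.

(** * Extension by density *)

(** The dense subspace is given through a parametrization e, so that both the
    completion of the domain of A (parametrized by the embedding) and the range of
    A (parametrized by A) are instances. *)
Lemma linear_extension (R : realType) (U V : normedModType R[i])
    (W : completeNormedModType R[i]) (S : set U) (e : U -> V) (f : U -> W)
    (c : R) : 0 <= c -> subspace_set S -> linear_on S e -> linear_on S f ->
  dense (e @` S) -> (forall s, S s -> nrm (f s) <= c * nrm (e s)) ->
  exists g : V -> W, [/\ forall s, S s -> g (e s) = f s,
    forall a x y, g (a *: x + y) = a *: g x + g y
  & forall x, nrm (g x) <= c * nrm x].
Proof.
move=> c0 sS le lf /dense_nrmP dS fe.
have feB s t : S s -> S t -> nrm (f s - f t) <= c * nrm (e s - e t).
  move=> Ss St; rewrite -(linear_onB sS lf)// -(linear_onB sS le)//.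
  by apply: fe; exact: subspaceB.
have approx x (d : R) : 0 < d -> exists2 s, S s & nrm (x - e s) < d.
  by move=> d0; have [_ [s Ss <-] xs] := dS x d d0; exists s.
(* The value at x is the point whose distances to the f s are the expected ones. *)
have /choice[g gP] : forall x, exists l,
    forall s, S s -> nrm (l - f s) <= c * nrm (x - e s).
  move=> x; have /choice[u uP] : forall n : nat, exists s,
      S s /\ nrm (x - e s) < n.+1%:R^-1.
    move=> n; have [|s Ss xs] := approx x (n.+1%:R^-1); first by rewrite invr_gt0.
    by exists s.
  have uu n m : (n <= m)%N -> nrm (f (u m) - f (u n)) <= (c * 2) * n.+1%:R^-1.
    move=> nm; have [Sn xn] := uP n; have [Sm xm] := uP m.
    apply: le_trans (feB _ _ Sm Sn) _; rewrite -mulrA ler_wpM2l//.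
    have mn : (m.+1%:R^-1 : R) <= n.+1%:R^-1 by rewrite lef_pV2 ?posrE// ler_nat.
    have := nrm_dist3 x (e (u m)) (e (u n)); rewrite nrmBC in xm.
    by move: mn xm xn; move: n.+1%:R^-1 m.+1%:R^-1 => rn rm; lra.
  have [d d0|l ul] := complete_seq _ uu; first exact: inv_nat_small.
  exists l => s Ss; apply/ler_addgt0Pl => d d0.
  have [n hn] := inv_nat_small (c * 3) d0; have := ul n; have [Sn xn] := uP n.
  have := nrm_dist3 (f (u n)) l (f s); have := feB _ _ Sn Ss.
  have := nrm_dist3 x (e (u n)) (e s); rewrite nrmBC in xn.
  move: hn xn; move: n.+1%:R^-1 => rn hn xn h1 h2 h3 h4.
  have := ler_wpM2l c0 (le_trans h1 (lerD (ltW xn) (lexx _))).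
  by move: (c * nrm (e (u n) - e s)) h2 => k h2; rewrite mulrDr; nra.
exists g; split.
- move=> s Ss; apply/eqP; rewrite -subr_eq0; apply/eqP/nrm_small_eq0 => d d0.
  by rewrite (le_trans (gP _ _ Ss))// subrr nrm0 mulr0 ltW.
- move=> a x y; apply/eqP; rewrite -subr_eq0; apply/eqP/nrm_small_eq0 => d d0.
  pose C := c * (nrm a + 1) * 2.
  have [n hn] := inv_nat_small C d0; set r := n.+1%:R^-1 in hn.
  have r0 : 0 < r by rewrite invr_gt0.
  have [s Ss xs] := approx x r r0; have [t St yt] := approx y r r0.
  have Sst : S (a *: s + t) by apply: subspaceD => //; exact: subspaceZ.
  have := gP (a *: x + y) _ Sst; rewrite le// lf//.
  rewrite (_ : a *: x + y - (a *: e s + e t) = a *: (x - e s) + (y - e t)); last first.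
    by rewrite opprD addrACA scalerBr.
  move=> h1; apply: le_trans (ltW hn).
  rewrite (_ : g (a *: x + y) - (a *: g x + g y) =
    (g (a *: x + y) - (a *: f s + f t)) -
    (a *: (g x - f s) + (g y - f t))); last first.
    have -> : a *: (g x - f s) + (g y - f t) = a *: g x + g y - (a *: f s + f t).
      by rewrite scalerBr addrACA -opprD.
    by rewrite opprB addrA subrK.
  have hx := le_trans (gP x s Ss) (ler_wpM2l c0 (ltW xs)).
  have hy := le_trans (gP y t St) (ler_wpM2l c0 (ltW yt)).
  have h2 : nrm (a *: (x - e s) + (y - e t)) <= (nrm a + 1) * r.
    rewrite mulrDl mul1r (le_trans (nrmD _ _))// lerD ?(ltW yt)// nrmZ.
    by rewrite ler_wpM2l ?nrm_ge0// ltW.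
  have h3 : nrm (a *: (g x - f s) + (g y - f t)) <= (nrm a + 1) * (c * r).
    rewrite mulrDl mul1r (le_trans (nrmD _ _))// lerD// nrmZ.
    by rewrite ler_wpM2l ?nrm_ge0.
  have h4 := le_trans h1 (ler_wpM2l c0 h2).
  have := nrmB (g (a *: x + y) - (a *: f s + f t)) (a *: (g x - f s) + (g y - f t)).
  rewrite /C => h5; apply: le_trans h5 _.
  have -> : c * (nrm a + 1) * 2 * r = c * ((nrm a + 1) * r) + (nrm a + 1) * (c * r).
    by ring.
  exact: lerD.
- move=> x; have := gP x 0 (subspace0 sS).
  by rewrite (linear_on0 sS le) (linear_on0 sS lf) !subr0.
Qed.

(** * The open mapping theorem *)

(** The Baire category theorem is applied to the real Banach space underlying a
    complex one. *)
Definition realified (R : realType) (V : completeNormedModType R[i]) : Type := V.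

Section realified.
Context {R : realType} {V : completeNormedModType R[i]}.
Local Notation VR := (realified V).

HB.instance Definition _ := GRing.Zmodule.copy VR V.

Definition realified_scale (r : R) (x : VR) : VR := r%:C *: (x : V).

Lemma realified_scaleA a b x :
  realified_scale a (realified_scale b x) = realified_scale (a * b) x.
Proof. by rewrite /realified_scale scalerA rmorphM. Qed.

Lemma realified_scale1 : left_id 1 realified_scale.
Proof. by move=> x; rewrite /realified_scale scale1r. Qed.

Lemma realified_scaleDr : right_distributive realified_scale +%R.
Proof. by move=> a x y; rewrite /realified_scale scalerDr. Qed.

Lemma realified_scaleDl x :
  {morph realified_scale^~ x : a b / a + b}.
Proof. by move=> a b; rewrite /realified_scale rmorphD/= scalerDl. Qed.

HB.instance Definition _ := GRing.Zmodule_isLmodule.Build R VR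
  realified_scaleA realified_scale1 realified_scaleDr realified_scaleDl.

Lemma realified_normZ (r : R) (x : VR) : nrm (r *: x : V) = `|r| * nrm (x : V).
Proof. by rewrite [r *: x]/(r%:C *: (x : V)) nrmZ nrmR. Qed.

HB.instance Definition _ := Lmodule_isNormed.Build R VR
  (@nrmD R V) realified_normZ (@nrm0_eq0 R V).

Lemma realified_normE (x : VR) : `|x| = nrm (x : V).
Proof. by []. Qed.

Lemma realified_complete (F : set_system VR) :
  ProperFilter F -> cauchy F -> cvg F.
Proof.
move=> FF /cauchy_ballP Fc.
have cF : cauchy (F : set_system V).
  apply/cauchy_ballP => e e0.
  have e0' : 0 < complex.Re e by move: e0; rewrite ltcE => /andP[_].
  have := Fc _ e0'; apply: filterS => -[x y].
  rewrite -!ball_normE /= => xy.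
  by rewrite -nrmE -[e](RRe_real (gtr0_real e0)) ltcR.
have /cvg_ex[l Fl] : cvg (F : set_system V) by exact: cauchy_cvg.
apply/cvg_ex; exists l => B /nbhs_normP[e /= e0 eB]; apply: Fl.
by apply/nbhs_nrmP; exists e => // y; exact: eB.
Qed.

HB.instance Definition _ := Uniform_isComplete.Build VR realified_complete.

End realified.

(** The points at positive distance from F n form an open set.  These open sets
    have no common point, so one of them is not dense by the Baire category
    theorem. *)
Lemma Baire_cover (R : realType) (X : completeNormedModType R[i])
    (F : nat -> set X) : (forall x, exists n, F n x) ->
  exists n x0, exists2 r : R, 0 < r & forall x, nrm (x0 - x) < r ->
    forall d : R, 0 < d -> exists2 y, F n y & nrm (x - y) < d.
Proof.
move=> Fcover.
pose O n : set (realified X) :=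
  [set x | exists2 d : R, 0 < d & forall y : X, F n y -> d <= nrm ((x : X) - y)].
have oO n : open (O n).
  rewrite openE => x [d d0 xd]; change (nbhs x (O n)).
  apply/(@nbhs_normP R (realified X)); exists (d / 2).
    by rewrite /= divr_gt0.
  move=> y /= xy; exists (d / 2); first by rewrite divr_gt0.
  move=> w Fw; have := xd w Fw; have := nrm_dist3 (y : X) (x : X) w.
  by rewrite realified_normE in xy; move: xy; lra.
have [n nd] : exists n, ~ dense (O n).
  apply: contrapT => h.
  have dO n : open (O n) /\ dense (O n).
    by split=> //; apply: contrapT => nd; apply: h; exists n.
  have /(_ setT)[||x [_ xO]] := Baire dO; [by exists 0|exact: openT|].
  have [n Fx] := Fcover x; have [d d0 /(_ _ Fx)] := xO n I.
  by rewrite subrr nrm0 leNgt d0.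
have [U [[x0 Ux] oU UO]] : exists U : set (realified X),
    [/\ U !=set0, open U & U `&` O n = set0].
  apply: contrapT => h; apply: nd => U U0 oU; apply/set0P/eqP => UO.
  by apply: h; exists U.
exists n, x0; have /nbhs_normP[r /= r0 rU] : nbhs x0 U by exact: open_nbhs_nbhs.
exists r => // x xr d d0; apply: contrapT => h.
suff : (U `&` O n) x by rewrite UO.
split; first exact: rU.
exists d => // y Fy; rewrite leNgt; apply/negP => xy.
by apply: h; exists y.
Qed.

(** By the Baire category theorem the image of some ball approximates all points
    of a ball, hence every y is approximated within |y| / 2 by the image of a
    vector of norm at most C |y|.  Correcting the error again and again gives a
    geometric series of vectors, whose sum is an exact preimage. *)
Lemma open_mapping (R : realType) (V X : completeNormedModType R[i])
    (B : V -> X) (c : R) :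
  (forall a x y, B (a *: x + y) = a *: B x + B y) ->
  (forall x, nrm (B x) <= c * nrm x) -> (forall y, exists x, B x = y) ->
  exists2 C : R, 0 <= C & forall y, exists2 x, B x = y & nrm x <= C * nrm y.
Proof.
move=> lB Bc surj.
have B0 := linear_fun0 lB; have BD := linear_funD lB.
have BZ := linear_funZ lB; have BB := linear_funB lB.
have [y|n [x0 [r r0 rF]]] := @Baire_cover R X (fun n => B @` [set x | nrm x <= n%:R]).
  have [x <-] := surj y; exists (Num.truncn (nrm x)).+1; exists x => //=.
  exact/ltW/truncnS_gt.
(* A vector of norm r / 2 is a difference of two points of the ball, each
   approximated by the image of a vector of norm at most n. *)
pose C : R := 4 * n%:R / r.
have C0 : 0 <= C by rewrite divr_ge0 ?mulr_ge0 ?(ltW r0).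
have near y : exists x, nrm x <= C * nrm y /\ nrm (y - B x) <= 2^-1 * nrm y.
  have [->|y0] := eqVneq y 0.
    by exists 0; rewrite B0 subr0 !nrm0 !mulr0.
  have ny := nrm_gt0 y0.
  pose t := r / 2 / nrm y; have t0 : 0 < t by rewrite !divr_gt0.
  have d0 : 0 < t * nrm y / 4 by rewrite divr_gt0// mulr_gt0.
  have tr : t * nrm y = r / 2 by rewrite /t divfK// gt_eqF.
  have [|_ [x1 /= hx1 <-] yx1] := rF (x0 + t%:C *: y) _ _ d0.
    rewrite opprD addrA subrr add0r nrmN nrmZ nrmR ger0_norm ?(ltW t0)// tr.
    by rewrite ltr_pdivrMr// ltr_pMr// ltr1n.
  have [|_ [x2 /= hx2 <-] yx2] := rF x0 _ _ d0; first by rewrite subrr nrm0.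
  exists (t^-1%:C *: (x1 - x2)); split.
    rewrite nrmZ nrmR ger0_norm ?invr_ge0 ?(ltW t0)// mulrC ler_pdivrMr//.
    rewrite mulrAC -mulrA tr /C.
    have := nrmB x1 x2; rewrite (_ : _ * (r / 2) = 2 * n%:R); first by lra.
    by field; rewrite gt_eqF.
  have -> : y - B (t^-1%:C *: (x1 - x2)) =
      t^-1%:C *: ((x0 + t%:C *: y - B x1) - (x0 - B x2)).
    have -> : x0 + t%:C *: y - B x1 - (x0 - B x2) = t%:C *: y - (B x1 - B x2).
      by rewrite !opprB addrC -(addrA x0) addrA subrK addrCA.
    by rewrite BZ BB [RHS]scalerBr scalerA -rmorphM/= mulVf ?scale1r// gt_eqF//.
  rewrite nrmZ nrmR ger0_norm ?invr_ge0 ?(ltW t0)// mulrC ler_pdivrMr// mulrAC -mulrA.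
  by have := nrmB (x0 + t%:C *: y - B x1) (x0 - B x2); lra.
move: C C0 near => C C0 /choice[s sP].
exists (2 * C) => [|y]; first exact: mulr_ge0.
pose res := fix res k := if k is k'.+1 then res k' - B (s (res k')) else y.
pose u := fix u k := if k is k'.+1 then u k' + s (res k') else 0.
have resE k : res k = y - B (u k).
  elim: k => [|k IH] /=; first by rewrite B0 subr0.
  by rewrite {1}IH BD opprD addrA.
have resN k : nrm (res k) <= 2^-1 ^+ k * nrm y.
  elim: k => [|k IH] /=; first by rewrite expr0 mul1r.
  by rewrite (le_trans (sP _).2)// exprS -mulrA ler_wpM2l ?invr_ge0.
have uu k m : (k <= m)%N ->
    nrm (u m - u k) <= 2 * C * nrm y * (2^-1 ^+ k - 2^-1 ^+ m).
  elim: m => [|m IH]; first by rewrite leqn0 => /eqP ->; rewrite !subrr nrm0 mulr0.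
  rewrite leq_eqVlt => /orP[/eqP ->|/IH km]; first by rewrite !subrr nrm0 mulr0.
  rewrite /= addrAC (le_trans (nrmD _ _))//.
  have := le_trans (sP (res m)).1 (ler_wpM2l C0 (resN m)).
  rewrite exprS; move: km; move: (nrm (s _)) (nrm (u m - _)) (2^-1 ^+ k) (2^-1 ^+ m) => a b p q.
  move: (nrm y) => N h1 h2; have := lerD h1 h2.
  by rewrite addrC => /le_trans; apply; rewrite le_eqVlt; apply/orP; left; apply/eqP; field.
have small K (e : R) : 0 < e -> exists k, K * 2^-1 ^+ k < e.
  move=> e0; have [k hk] := inv_nat_small `|K| e0; exists k.
  apply: le_lt_trans hk; apply: le_trans (ler_wpM2r _ (ler_norm K)) _.
    by rewrite exprn_ge0// invr_ge0.
  rewrite ler_wpM2l// exprVn lef_pV2 ?posrE ?exprn_gt0//.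
  by rewrite -natrX ler_nat ltn_expl.
have [e e0|k m km|x ux] := @complete_seq R V u (fun k => 2 * C * nrm y * 2^-1 ^+ k).
- exact: small.
- rewrite (le_trans (uu _ _ km))// ler_wpM2l ?mulr_ge0 ?nrm_ge0//.
  by rewrite gerBl exprn_ge0// invr_ge0.
exists x; last by have := ux 0%N; rewrite /= subr0 expr0 mulr1.
apply/eqP; rewrite -subr_eq0; apply/eqP/nrm_small_eq0 => e e0.
have [k hk] := small (`|c| * (2 * C * nrm y) + nrm y) _ e0.
apply: le_trans (ltW hk).
rewrite (_ : B x - y = B (x - u k) - res k); last first.
  by rewrite resE BB opprB addrA subrK.
rewrite mulrDl (le_trans (nrmB _ _))// lerD//; last by rewrite mulrC resN.
apply: le_trans (Bc _) _; rewrite (le_trans (ler_wpM2r (nrm_ge0 _) (ler_norm c)))//.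
by rewrite -[leRHS]mulrA ler_wpM2l.
Qed.

(** * Resolvents of self-adjoint operators *)

Section resolvent.
Context {R : realType} {H : hilbertType R}.
Variables (S : operator H H) (z : R[i]).
Hypotheses (lS : linear_operator S) (zS : resolvent_set S z).

Lemma dom_resolvent y : dom S (resolvent S z y).
Proof. by have [] := op_invP zS y. Qed.

Lemma op_resolvent y : S (resolvent S z y) = z *: resolvent S z y - y.
Proof.
have [_ /= zy] := op_invP zS y.
by rewrite -[X in _ - X]zy opprD opprK addrCA subrr addr0.
Qed.

Lemma resolvent_uniq x y : dom S x -> - S x + z *: x = y -> resolvent S z y = x.
Proof. by move=> Dx xy; apply: op_inv_uniq. Qed.

Lemma resolvent_linear a x y :
  resolvent S z (a *: x + y) = a *: resolvent S z x + resolvent S z y.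
Proof.
have [sS linS] := lS; have Dx := dom_resolvent x; have Dy := dom_resolvent y.
apply: resolvent_uniq; first by apply: subspaceD => //; exact: subspaceZ.
rewrite linS// !op_resolvent scalerBr (scalerDr z) [z *: (a *: _)]scalerA mulrC -scalerA.
by rewrite opprD !opprB addrACA !subrK.
Qed.

Lemma resolvent_bound : exists2 c : R, 0 <= c &
  forall y, nrm (resolvent S z y) <= c * nrm y.
Proof. exact: op_inv_bound zS. Qed.

End resolvent.

Lemma resolvent_adjoint (R : realType) (H : hilbertType R) (A : operator H H)
    (z : R[i]) (x y : H) : self_adjoint A -> resolvent_set A z ->
  hdot (resolvent A z x) y = hdot x (resolvent A z^* y).
Proof.
move=> saA zA; have zA' := resolvent_set_conj saA zA.
set u := resolvent A z x; set v := resolvent A z^* y.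
have Du : dom A u by exact: dom_resolvent.
have Dv : dom A v by exact: dom_resolvent.
have <- : - A u + z *: u = x by rewrite op_resolvent// opprB subrK.
have <- : - A v + z^* *: v = y by rewrite op_resolvent// opprB subrK.
by rewrite hdotDr hdotDl hdotNr hdotNl hdotZr hdotZl (self_adjoint_sym saA).
Qed.

Section injective_self_adjoint.
Context {R : realType} {H : hilbertType R}.
Variable A : operator H H.
Hypotheses (A_sa : self_adjoint A)
  (A_inj : forall x y, dom A x -> dom A y -> A x = A y -> x = y).

Let A_linear : linear_operator A. Proof. by case: A_sa. Qed.

(** A vector orthogonal to the range is in the kernel of the adjoint, which is A
    itself. *)
Lemma dense_range : dense (A @` dom A).
Proof.
have [sA lA] := A_linear; apply: dense_orthogonal.
  split; first by exists 0; [exact: subspace0|exact: linear_on0 sA _ lA].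
  move=> a _ _ [x Dx <-] [y Dy <-]; exists (a *: x + y); last exact: lA.
  by apply: subspaceD => //; exact: subspaceZ.
move=> w wA; have [|Dw Aw] := @self_adjoint_max _ _ A w 0 A_sa.
  by move=> x Dx; rewrite wA ?hdot0l//; exists x.
apply: A_inj => //; first exact: subspace0.
by rewrite Aw (linear_on0 sA lA).
Qed.

(** The operators z R(z) with z on the imaginary axis are contractions, and on the
    dense range of A they are O(z). *)
Lemma resolvent_vanishes (x : H) (e : R) : 0 < e ->
  exists2 d : R, 0 < d & forall r : R, r != 0 -> `|r| < d ->
    nrm (('i * r%:C) *: resolvent A ('i * r%:C) x) < e.
Proof.
move=> e0; have /dense_nrmP dA := dense_range.
have Imi (r : R) : complex.Im ('i * r%:C) = r.
  by rewrite /= mul0r mul1r add0r.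
have rho (r : R) : r != 0 -> resolvent_set A ('i * r%:C).
  by move=> r0; apply: nonreal_resolvent; rewrite // Imi.
have nri (r : R) : nrm ('i * r%:C) = `|r|.
  by rewrite nrmM nrmR /nrm normCi mul1r.
have contr (r : R) y : r != 0 ->
    nrm (('i * r%:C) *: resolvent A ('i * r%:C) y) <= nrm y.
  move=> r0; rewrite nrmZ nri -[`|r|]/(`|r|).
  have := nonreal_bound ('i * r%:C) A_sa (dom_resolvent (rho r r0) y).
  by rewrite Imi op_resolvent ?opprB ?subrK//; exact: rho.
have e20 : 0 < e / 2 by rewrite divr_gt0.
have [_ [u Du <-] xu] := dA x _ e20.
pose K := 2 * nrm u + 1; have K0 : 0 < K by rewrite ltr_wpDl ?mulr_ge0 ?nrm_ge0.
exists (e / 2 / K); first exact: divr_gt0.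
move=> r r0; rewrite ltr_pdivlMr// => rK.
set z := 'i * r%:C; have zA : resolvent_set A z by exact: rho.
have RA : resolvent A z (A u) = z *: resolvent A z u - u.
  have [sA lA] := A_linear; have Dv := dom_resolvent zA u.
  apply: resolvent_uniq => //; first by apply: subspaceB => //; exact: subspaceZ.
  rewrite (linear_onB sA lA)//; last exact: subspaceZ.
  by rewrite (linear_onZ sA lA)// op_resolvent// opprB subrK.
have -> : resolvent A z x = resolvent A z (x - A u) + resolvent A z (A u).
  by rewrite -[resolvent A z (x - _)]scale1r -resolvent_linear// scale1r subrK.
rewrite scalerDr (le_lt_trans (nrmD _ _))//.
have := contr r (x - A u) r0; have := contr r u r0; rewrite -/z => h1 h2.
have : nrm (z *: resolvent A z (A u)) <= `|r| * K.
  rewrite RA nrmZ nri ler_wpM2l// (le_trans (nrmB _ _))// /K.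
  by have := nrm_ge0 u; lra.
by move: xu rK h1 h2; lra.
Qed.

End injective_self_adjoint.

(** * The completion of the domain *)

Lemma bounded_continuous (R : realType) (V W : normedModType R[i]) (f : V -> W)
    (c : R) : (forall a x y, f (a *: x + y) = a *: f x + f y) ->
  (forall x, nrm (f x) <= c * nrm x) -> continuous f.
Proof.
move=> lf fc; apply: (@lipschitz_continuous _ _ _ _ c) => x y.
by rewrite -(linear_funB lf).
Qed.

Lemma adjoint_everywhereE (R : realType) (H : hilbertType R)
    (X : normedModType R[i]) (f : H -> X) (c : R) (l : dual X) (x : H) :
  (forall a x y, f (a *: x + y) = a *: f x + f y) ->
  (forall x, nrm (f x) <= c * nrm x) ->
  hdot (riesz_inv (adjoint (op_everywhere f) l)) x = l (f x).
Proof.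
move=> lf fc; have [||m mE] := @bounded_dual R H (fun x => l (f x)) (nrm l * c).
- by move=> a u v; rewrite lf dual_linear.
- move=> u; apply: le_trans (nrm_dual _ _) _.
  by rewrite -mulrA ler_wpM2l ?nrm_ge0.
rewrite riesz_invE /adjoint /=.
by case: xgetP => [m' _ /(_ x)->//|/(_ m)[]].
Qed.

Section completion.
Context {R : realType} {H : hilbertType R} {X Dhat : completeNormedModType R[i]}.
Variables (A : operator H H) (tau : H -> X) (I : H -> Dhat).
Hypotheses (A_sa : self_adjoint A)
  (A_inj : forall x y, dom A x -> dom A y -> A x = A y -> x = y)
  (tau_linear : linear_on (dom A) tau)
  (h3 : exists2 c : R[i], 0 < c &
     forall phi, dom A phi -> `|tau phi| <= c * `|A phi|)
  (I_completion : is_completion A I).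

Let A_linear : linear_operator A. Proof. by case: A_sa. Qed.

(** By (h3), tau is bounded as a function of A phi, and the range of A is dense. *)
Lemma trace_factorization : exists (T : H -> X) (c : R),
  [/\ forall x, dom A x -> T (A x) = tau x,
      forall a x y, T (a *: x + y) = a *: T x + T y
    & forall x, nrm (T x) <= c * nrm x].
Proof.
have [c c0 tauc] := h3; have [sA lA] := A_linear.
have [|T [TA lT Tc]] := linear_extension (nrm_ge0 c) sA lA tau_linear (dense_range A_sa A_inj).
  by move=> x Dx; exact: nrm_le_mul (tauc x Dx).
by exists T, (nrm c).
Qed.

Lemma extension_eq (Y : normedModType R[i]) (f : H -> Y) (g : Dhat -> Y) :
  continuous g -> (forall x, dom A x -> g (I x) = f x) -> extension A I f = g.
Proof.
move=> cg gf; rewrite /extension; case: xgetP => [h _ [ch hf]|/(_ g)[]//].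
have [_ _ dI] := I_completion.
by apply: (continuous_dense_eq ch cg dI) => _ [x Dx <-]; rewrite hf// gf.
Qed.

(** The inverse J of the extension of A is the extension of the embedding along A.
    On the domain, I (R(z) x) = J (A R(z) x) = J (z R(z) x - x), which tends to
    J (- x) along the imaginary axis. *)
Lemma A_hat_spec :
  [/\ forall x, dom A x -> A_hat A I (I x) = A x,
      forall a p q, A_hat A I (a *: p + q) = a *: A_hat A I p + A_hat A I q,
      injective (A_hat A I),
      continuous (A_hat A I)
    & forall x, A_hat A I (Rlim A I x) = - x].
Proof.
have [sA lA] := A_linear; have [lI nI dI] := I_completion.
have nIA x : dom A x -> nrm (I x) = nrm (A x) by move=> Dx; rewrite /nrm nI.
have [x Dx|g [gI lg gc]] := linear_extension ler01 sA lI lA dI.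
  by rewrite mul1r nIA.
have [x Dx|J [JA lJ Jc]] :=
    linear_extension ler01 sA lA lI (dense_range A_sa A_inj).
  by rewrite mul1r nIA.
have cg := bounded_continuous lg gc; have cJ := bounded_continuous lJ Jc.
have -> : A_hat A I = g by exact: extension_eq.
have Jg p : J (g p) = p.
  have cJg : continuous (J \o g).
    by move=> q; apply: continuous_comp; [exact: cg|exact: cJ].
  have cid : continuous (@id Dhat) by move=> q; exact: cvg_id.
  suff : J \o g = id by move/(congr1 (@^~ p)).
  by apply: (continuous_dense_eq cJg cid dI) => _ [x Dx <-] /=; rewrite gI// JA.
have gJ y : g (J y) = y.
  have cgJ : continuous (g \o J).
    by move=> q; apply: continuous_comp; [exact: cJ|exact: cg].
  have cid : continuous (@id H) by move=> q; exact: cvg_id.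
  suff : g \o J = id by move/(congr1 (@^~ y)).
  apply: (continuous_dense_eq cgJ cid (dense_range A_sa A_inj)).
  by move=> _ [x Dx <-] /=; rewrite JA// gI.
split=> // [p q pq|x]; first by rewrite -[p]Jg pq Jg.
suff -> : Rlim A I x = J (- x) by rewrite gJ.
apply: cvg_lim; first exact: norm_hausdorff.
move=> B /nbhs_nrmP[e e0 eB].
have [d d0 dR] := resolvent_vanishes A_sa A_inj x e0.
apply/nbhs_normP; exists d => // r; rewrite /= sub0r normrN => rd r0; apply: eB.
have zA : resolvent_set A ('i * r%:C).
  by apply: nonreal_resolvent => //; rewrite /= mul0r mul1r add0r.
have Dr := dom_resolvent zA x.
have -> : J (- x) - I (resolvent A ('i * r%:C) x) =
    - J (('i * r%:C) *: resolvent A ('i * r%:C) x).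
  by rewrite -JA// op_resolvent// (linear_funB lJ) !(linear_funN lJ) opprD opprK addrCA addNr addr0.
rewrite nrmN (le_lt_trans (Jc _))// mul1r; exact: dR.
Qed.

Lemma tau_hatE (T : H -> X) (c : R) :
  (forall x, dom A x -> T (A x) = tau x) ->
  (forall a x y, T (a *: x + y) = a *: T x + T y) ->
  (forall x, nrm (T x) <= c * nrm x) ->
  forall p, tau_hat A tau I p = T (A_hat A I p).
Proof.
move=> TA lT Tc p; have [AI lAh _ cAh _] := A_hat_spec.
rewrite /tau_hat (@extension_eq _ _ (T \o A_hat A I))// => [q|x Dx /=].
  by apply: continuous_comp; [exact: cAh|exact: (bounded_continuous lT Tc)].
by rewrite AI// TA.
Qed.

End completion.

(** * Lower bounds from gamma *)

(** The two infima are finite as soon as there is a common unit vector, since an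
    infimum equal to -oo contradicts the hypothesis; their sum is then the bound.
    Without such a vector there is nothing to bound. *)
Lemma gamma_bounded_below (R : realType) (X : normedModType R[i])
    (L M : operator (dual X) X) : (- gamma L < gamma M)%E ->
  exists2 d : R, 0 < d & forall l, dom L l -> dom M l -> nrm l = 1 ->
    d <= complex.Re (l (L l) + l (M l)).
Proof.
move=> LM; have [[l1 [D1 D2 n1]]|nl] :=
  pselect (exists l, [/\ dom L l, dom M l & nrm l = 1]); last first.
  by exists 1 => // l D1 D2 n1; case: nl; exists l.
have gle (N : operator (dual X) X) l : dom N l -> nrm l = 1 ->
    (gamma N <= (complex.Re (l (N l)))%:E)%E.
  by move=> DN ln; apply: ereal_inf_lbound; exists l => //; split; rewrite // -nrmE ln.
have := gle L _ D1 n1; have := gle M _ D2 n1.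
case EL: (gamma L) LM => [p||] //; case EM: (gamma M) => [q||] //.
rewrite -EFinN lte_fin => pq _ _; exists (p + q); first by lra.
move=> l DL DM ln; rewrite raddfD/=; apply: lerD; rewrite -lee_fin.
  by rewrite -EL gle.
by rewrite -EM gle.
Qed.

(** * The boundary map and its adjoint *)

Section boundary.
Context {R : realType} {H : hilbertType R} {X Dhat : completeNormedModType R[i]}.
Variables (A : operator H H) (tau : H -> X) (I : H -> Dhat) (T : H -> X) (cT : R).
Hypotheses (A_sa : self_adjoint A)
  (A_inj : forall x y, dom A x -> dom A y -> A x = A y -> x = y)
  (TA : forall x, dom A x -> T (A x) = tau x)
  (T_linear : forall a x y, T (a *: x + y) = a *: T x + T y)
  (T_bound : forall x, nrm (T x) <= cT * nrm x)
  (h1 : forall x : X, exists2 phi, dom A phi & tau phi = x)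
  (h2 : range_adjoint A tau `&` embedded_dual A = [set fun=> 0])
  (I_completion : is_completion A I).

Let A_linear : linear_operator A. Proof. by case: A_sa. Qed.

(** The operator T': the adjoint of T, with the dual of H identified with H. *)
Definition trace_adjoint (l : dual X) : H := riesz_inv (adjoint (op_everywhere T) l).

Lemma trace_adjointE l x : hdot (trace_adjoint l) x = l (T x).
Proof. exact: adjoint_everywhereE T_linear T_bound. Qed.

Lemma trace_adjoint_conj_linear a l m :
  trace_adjoint (a *: l + m) = a^* *: trace_adjoint l + trace_adjoint m.
Proof.
by apply: hdot_inj => x; rewrite hdotDl hdotZl conjCK !trace_adjointE.
Qed.

Lemma trace_adjointB l m : trace_adjoint (l - m) = trace_adjoint l - trace_adjoint m.
Proof.
by rewrite addrC -scaleN1r trace_adjoint_conj_linear rmorphN rmorph1 scaleN1r addrC.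
Qed.

Lemma trace_adjoint_tau l x : dom A x -> hdot (trace_adjoint l) (A x) = l (tau x).
Proof. by move=> Dx; rewrite trace_adjointE TA. Qed.

Lemma nrm_trace_adjoint l : nrm (trace_adjoint l) <= `|cT| * nrm l.
Proof.
have [g0|g0] := eqVneq (trace_adjoint l) 0; first by rewrite g0 nrm0 mulr_ge0 ?nrm_ge0.
rewrite -(@ler_pM2l _ (nrm (trace_adjoint l))) ?nrm_gt0//.
have -> : nrm (trace_adjoint l) * nrm (trace_adjoint l) =
    nrm (hdot (trace_adjoint l) (trace_adjoint l)).
  by rewrite hdot_nrm nrmR ger0_norm ?sqr_ge0.
rewrite trace_adjointE (le_trans (nrm_dual _ _))// mulrC mulrA ler_wpM2r ?nrm_ge0//.
rewrite (le_trans (T_bound _))// mulrC ler_wpM2l ?nrm_ge0 ?ler_norm//.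
Qed.

(** If T' l is in the domain of A, then l o tau is the scalar product with A T' l,
    which (h2) allows only for l o tau = 0. *)
Lemma trace_adjoint_dom l : dom A (trace_adjoint l) -> l = 0.
Proof.
move=> Dl; pose f : dom A -> R[i] := fun phi => l (tau (val phi)).
have : (range_adjoint A tau `&` embedded_dual A) f.
  split; first by exists l.
  exists (riesz (A (trace_adjoint l))); apply/funext => phi.
  have Dphi : dom A (val phi) by exact: set_mem (valP phi).
  by rewrite riesz_invE /= -(self_adjoint_sym A_sa)// trace_adjoint_tau.
rewrite h2 => f0; apply: dual_ext => x; have [phi Dphi <-] := h1 x.
have := congr1 (fun g => g (exist _ phi (mem_set Dphi))) f0.
by rewrite /f dual0l.
Qed.

Lemma breveG_linear z : resolvent_set A z -> forall a x y,
  breveG A tau z (a *: x + y) = a *: breveG A tau z x + breveG A tau z y.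
Proof.
move=> zA a x y; have [sA lA] := A_linear.
have Dx := dom_resolvent zA x; have Dy := dom_resolvent zA y.
rewrite /breveG -!TA ?resolvent_linear//; try exact: dom_resolvent.
  by rewrite lA// T_linear.
by apply: subspaceD => //; exact: subspaceZ.
Qed.

Lemma breveG_bound z : resolvent_set A z -> exists2 c : R, 0 <= c &
  forall x, nrm (breveG A tau z x) <= c * nrm x.
Proof.
move=> zA; have [c c0 Rc] := resolvent_bound zA.
exists (`|cT| * (nrm z * c + 1)).
  by rewrite mulr_ge0// addr_ge0// mulr_ge0// nrm_ge0.
move=> x; have Dx := dom_resolvent zA x.
rewrite /breveG -TA// op_resolvent// (le_trans (T_bound _))//.
rewrite (le_trans (ler_wpM2r (nrm_ge0 _) (ler_norm cT)))// -mulrA ler_wpM2l//.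
rewrite (le_trans (nrmB _ _))// mulrDl mul1r lerD// nrmZ -mulrA ler_wpM2l ?nrm_ge0//.
Qed.

Lemma breveG_surj z : resolvent_set A z -> forall x, exists y, breveG A tau z y = x.
Proof.
move=> zA x; have [u Du <-] := h1 x; exists (- A u + z *: u).
by rewrite /breveG (resolvent_uniq zA Du).
Qed.

(** The map breveG(z) is a bounded surjection from H to X. *)
Lemma breveG_open z : resolvent_set A z -> exists2 C : R, 0 <= C &
  forall x, exists2 y, breveG A tau z y = x & nrm y <= C * nrm x.
Proof.
move=> zA; have [c _ Bc] := breveG_bound zA.
exact: open_mapping (breveG_linear zA) Bc (breveG_surj zA).
Qed.

Lemma G_adj z l x : resolvent_set A z ->
  hdot (G A tau z l) x = l (breveG A tau z^* x).
Proof.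
move=> zA; have zA' := resolvent_set_conj A_sa zA.
have [c _ Bc] := breveG_bound zA'.
exact: adjoint_everywhereE (breveG_linear zA') Bc.
Qed.

Lemma GE z l : resolvent_set A z ->
  G A tau z l = z *: resolvent A z (trace_adjoint l) - trace_adjoint l.
Proof.
move=> zA; have zA' := resolvent_set_conj A_sa zA.
apply: hdot_inj => x; have Dx := dom_resolvent zA' x.
rewrite G_adj// /breveG -trace_adjoint_tau// op_resolvent// hdotBr hdotZr.
by rewrite hdotBl hdotZl resolvent_adjoint.
Qed.

(** The operator G(z) is the adjoint of the map breveG at the conjugate of z, for
    which every x has a preimage of norm at most C |x|; so |l x| is at most
    C |G(z) l| |x|. *)
Lemma G_bounded_below z : resolvent_set A z -> exists2 C : R, 0 <= C &
  forall l, nrm l <= C * nrm (G A tau z l).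
Proof.
move=> zA; have [C C0 BC] := breveG_open (resolvent_set_conj A_sa zA).
exists C => // l; apply: nrm_dual_le; first by rewrite mulr_ge0 ?nrm_ge0.
move=> x; have [y <- yx] := BC x; rewrite -G_adj//.
rewrite (le_trans (nrm_hdot _ _))// mulrAC mulrC ler_wpM2r ?nrm_ge0//.
Qed.

(** The value of f at any preimage of x depends only on x; choosing preimages of
    controlled norm bounds the induced functional on X. *)
Lemma factor_functional z (f : H -> R[i]) (c : R) : resolvent_set A z ->
  linear (f : H -> R[i]^o) -> (forall x, nrm (f x) <= c * nrm x) ->
  (forall x, breveG A tau z x = 0 -> f x = 0) ->
  exists l : dual X, forall x, l (breveG A tau z x) = f x.
Proof.
move=> zA lf fc fker; have BL := breveG_linear zA.
have [C C0 /(_ _)/cid2-/all_sig2[s sB sC]] := breveG_open zA.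
have fB x y : breveG A tau z x = breveG A tau z y -> f x = f y.
  move=> xy; apply/eqP; rewrite -subr_eq0; apply/eqP.
  rewrite -(@linear_funB _ _ _ (f : H -> R[i]^o) lf).
  by apply: fker; rewrite (linear_funB BL) xy subrr.
have [a x y|x|l lE] := @bounded_dual R X (fun x => f (s x)) (`|c| * C).
- by rewrite -lf; apply: fB; rewrite BL !sB.
- apply: le_trans (fc _) _; rewrite -mulrA.
  by rewrite (le_trans (ler_wpM2r (nrm_ge0 _) (ler_norm c)))// ler_wpM2l.
- by exists l => x; rewrite lE; apply: fB; rewrite sB.
Qed.

(** The space X is a quotient of H: the preimage p of x that is orthogonal to the
    kernel of breveG(z) defines a functional on X whose value at x is |p|^2. *)
Lemma dual_separates z (x : X) : resolvent_set A z ->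
  (forall l : dual X, l x = 0) -> x = 0.
Proof.
move=> zA lx; have [h hx] := breveG_surj zA x.
have BL := breveG_linear zA; have [c c0 Bc] := breveG_bound zA.
have B0 := linear_fun0 BL.
have kerS : subspace_set [set y | breveG A tau z y = 0].
  by split=> // a u v /= u0 v0; rewrite BL u0 v0 scaler0 addr0.
have [p [pM ph]] := orthogonal_projection h kerS.
have Bp : breveG A tau z p = x.
  apply/eqP; rewrite -subr_eq0 -oppr_eq0 opprB; apply/eqP/nrm_small_eq0 => e e0.
  have [m /= Bm hm] := ph _ (divr_gt0 e0 (ltr_wpDl c0 ltr01)).
  have -> : x - breveG A tau z p = breveG A tau z (h - p - m).
    by rewrite !(linear_funB BL) Bm subr0 hx.
  rewrite (le_trans (Bc _))//; rewrite ltr_pdivlMr ?ltr_wpDl// in hm.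
  by rewrite (le_trans _ (ltW hm))// mulrC ler_wpM2l ?nrm_ge0// lerDl.
have [||y|l lE] := @factor_functional z (hdot p) (nrm p) zA.
- exact: hdot_linear.
- by move=> y; exact: nrm_hdot.
- exact: pM.
have := lE p; rewrite Bp lx hdotxx => /esym/eqP.
by rewrite expf_eq0/= normr_eq0 => /eqP p0; rewrite -Bp p0.
Qed.

(** Applying the injective extension of A to the decomposition removes the
    dependence on z, because G(z) Q = z R(z) T' Q - T' Q and the extension maps
    K(z) Q to - z G(z) Q. *)
Lemma decompositionP z phi p Q : resolvent_set A z ->
  decomposition A tau I z phi p Q <->
  dom A (phi + trace_adjoint Q) /\ A_hat A I p = A (phi + trace_adjoint Q).
Proof.
move=> zA; have [sA lA] := A_linear.
have [AI lAh Ainj _ ARlim] := A_hat_spec A_sa A_inj I_completion.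
have DR : dom A (z *: resolvent A z (trace_adjoint Q)).
  by apply: subspaceZ => //; exact: dom_resolvent.
have GD : phi - G A tau z Q = phi + trace_adjoint Q - z *: resolvent A z (trace_adjoint Q).
  by rewrite GE// opprB addrA.
have AK : A_hat A I (K A tau I z Q) = - (z *: G A tau z Q).
  by rewrite (linear_funZ lAh) ARlim scalerN.
have AG : dom A (phi + trace_adjoint Q) ->
    A (phi - G A tau z Q) = A (phi + trace_adjoint Q) - z *: G A tau z Q.
  move=> D1; rewrite GD (linear_onB sA lA)// (linear_onZ sA lA); last exact: dom_resolvent.
  by rewrite op_resolvent// -GE.
split=> [[D1 IE]|[D1 AE]].
  have D2 : dom A (phi + trace_adjoint Q).
    rewrite -(subrK (z *: resolvent A z (trace_adjoint Q)) (phi + _)) -GD.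
    exact: subspaceD.
  split=> //; have := congr1 (A_hat A I) IE.
  by rewrite AI// AG// (linear_funD lAh) AK => /addIr.
have D2 : dom A (phi - G A tau z Q) by rewrite GD; exact: subspaceB.
by split=> //; apply: Ainj; rewrite AI// AG// (linear_funD lAh) AK AE.
Qed.

Lemma decomposition_uniq z phi p Q p' Q' : resolvent_set A z ->
  decomposition A tau I z phi p Q -> decomposition A tau I z phi p' Q' ->
  p = p' /\ Q = Q'.
Proof.
move=> zA /(decompositionP _ _ _ zA)[D1 p1] /(decompositionP _ _ _ zA)[D2 p2].
have [sA lA] := A_linear; have [_ _ Ainj _ _] := A_hat_spec A_sa A_inj I_completion.
have QQ : Q = Q'.
  apply/eqP; rewrite -subr_eq0; apply/eqP/trace_adjoint_dom; rewrite trace_adjointB.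
  have := subspaceB sA D1 D2; rewrite opprD addrACA subrr add0r//.
by split=> //; apply: Ainj; rewrite p1 p2 QQ.
Qed.

Lemma GammaE z l : Gamma A tau I z l = - (z *: T (G A tau z l)).
Proof.
have [_ lAh _ _ ARlim] := A_hat_spec A_sa A_inj I_completion.
rewrite /Gamma (tau_hatE A_sa A_inj I_completion TA T_linear T_bound).
by rewrite (linear_funZ lAh) ARlim (linear_funZ T_linear) (linear_funN T_linear) scalerN.
Qed.

(** * The self-adjoint extension *)

Variables (Theta : operator (dual X) X) (z0 : R[i]).
Hypotheses (Theta_sa : conj_self_adjoint Theta) (z0_rho : resolvent_set A z0).

Let tau_linear : linear_on (dom A) tau.
Proof.
have [sA lA] := A_linear; move=> a x y Dx Dy; rewrite -!TA//.
  by rewrite lA.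
by apply: subspaceD => //; exact: subspaceZ.
Qed.

Let AT := A_Theta A tau I Theta z0.

Lemma Theta_sym (l m : dual X) : dom Theta l -> dom Theta m ->
  m (Theta l) = (l (Theta m))^*.
Proof.
move=> Dl Dm; have [_ _ _ [DE vE]] := Theta_sa.
have Dl' : dom (conj_adjoint Theta) l by rewrite -DE.
have := vE l Dl => /= /(congr1 (fun k : dual (dual X) => k m)) /= ->.
by have /= -> := xgetPex 0 Dl'.
Qed.

(** This is the inclusion of the adjoint of Theta in Theta.  The dense domain of
    Theta determines the value x because functionals separate the points of X. *)
Lemma Theta_max (l : dual X) (x : X) : (forall m, dom Theta m -> m x = (l (Theta m))^*) ->
  dom Theta l /\ Theta l = x.
Proof.
move=> lx; have [_ dT _ [DE vE]] := Theta_sa.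
have Dl' : dom (conj_adjoint Theta) l by exists (bidual_embedding x).
have Dl : dom Theta l by rewrite [dom Theta]DE.
split=> //; apply/eqP; rewrite -subr_eq0; apply/eqP.
apply: (dual_separates z0_rho) => m.
apply: (@nrm_small_eq0 _ R[i]^o) => e e0.
have c0 : 0 < nrm (Theta l - x) + 1 by rewrite ltr_wpDl ?nrm_ge0.
have [m' Dm' mm'] := (dense_nrmP _).1 dT m _ (divr_gt0 e0 c0).
have -> : m (Theta l - x) = (m - m') (Theta l - x).
  by rewrite dualBl (dualBr m') Theta_sym// -lx// subrr subr0.
rewrite (le_trans (nrm_dual _ _))//; rewrite ltr_pdivlMr// in mm'.
by rewrite (le_trans _ (ltW mm'))// ler_wpM2l ?nrm_ge0// lerDl.
Qed.

Lemma admissibleP phi p Q : admissible A tau I Theta z0 phi p Q <->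
  [/\ dom Theta Q, dom A (phi + trace_adjoint Q), A_hat A I p = A (phi + trace_adjoint Q)
    & tau (phi + trace_adjoint Q) = Theta Q].
Proof.
have decP := decompositionP phi p Q z0_rho.
have tauE := tau_hatE A_sa A_inj I_completion TA T_linear T_bound.
split=> [[DQ /decP[D1 pE]]|[DQ D1 pE tE]].
  by rewrite tauE pE TA.
by split=> //; [exact/decP|rewrite tauE pE TA].
Qed.

Lemma admissible_value phi p Q : admissible A tau I Theta z0 phi p Q ->
  AT phi = A_hat A I p.
Proof.
move=> adm; rewrite /AT /=; case: xgetP => [_ _ [p' [Q' [adm' ->]]]|].
  have [_ d' _] := adm'; have [_ d _] := adm.
  by have [-> _] := decomposition_uniq z0_rho d' d.
by move=> /(_ (A_hat A I p))[]; exists p, Q.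
Qed.

Lemma A_Theta_mk psi Q : dom A psi -> dom Theta Q -> tau psi = Theta Q ->
  dom AT (psi - trace_adjoint Q) /\ AT (psi - trace_adjoint Q) = A psi.
Proof.
move=> Dpsi DQ tE; have [AI _ _ _ _] := A_hat_spec A_sa A_inj I_completion.
have adm : admissible A tau I Theta z0 (psi - trace_adjoint Q) (I psi) Q.
  by apply/admissibleP; rewrite subrK AI.
by split; [exists (I psi), Q|rewrite (admissible_value adm) AI].
Qed.

Lemma A_Theta_elim phi : dom AT phi -> exists psi Q,
  [/\ dom A psi, dom Theta Q, tau psi = Theta Q, phi = psi - trace_adjoint Q & AT phi = A psi].
Proof.
move=> [p [Q adm]]; have [DQ D1 pE tE] := (admissibleP _ _ _).1 adm.
by exists (phi + trace_adjoint Q), Q; rewrite addrK (admissible_value adm).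
Qed.

Lemma A_Theta_ker phi : dom A phi -> tau phi = 0 ->
  dom AT phi /\ AT phi = A phi.
Proof.
have [[sT lT] _ _ _] := Theta_sa.
have T0 : Theta 0 = 0.
  have := lT (-1) 0 0 (subspace0 sT) (subspace0 sT).
  by rewrite scaler0 add0r rmorphN rmorph1 scaleN1r addNr.
have b0 : trace_adjoint 0 = 0 by have := trace_adjointB 0 0; rewrite !subrr.
move=> Dphi tphi; have := @A_Theta_mk phi 0 Dphi (subspace0 sT).
by rewrite b0 subr0 tphi T0; apply.
Qed.

Lemma A_Theta_linear : linear_operator AT.
Proof.
have [sA lA] := A_linear; have [[sT lT] _ _ _] := Theta_sa.
have comb a x y : dom AT x -> dom AT y ->
    dom AT (a *: x + y) /\ AT (a *: x + y) = a *: AT x + AT y.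
  move=> /A_Theta_elim[u [P [Du DP tu xE ->]]] /A_Theta_elim[v [Q [Dv DQ tv yE ->]]].
  have -> : a *: x + y = (a *: u + v) - trace_adjoint (a^* *: P + Q).
    rewrite xE yE trace_adjoint_conj_linear conjCK scalerBr addrACA.
    by rewrite -opprD.
  rewrite -lA//; apply: A_Theta_mk.
  - by apply: subspaceD => //; exact: subspaceZ.
  - by apply: subspaceD => //; exact: subspaceZ.
  - by rewrite tau_linear// lT// conjCK tu tv.
split; last by move=> a x y Dx Dy; have [] := comb a x y Dx Dy.
split; last by move=> a x y Dx Dy; have [] := comb a x y Dx Dy.
by have [] := A_Theta_ker (subspace0 sA) (linear_on0 sA tau_linear).
Qed.

(** For an adjoint pair (y, w), the functional psi |-> <w, psi> - <y, A psi> vanishes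
    on the kernel of tau, so it is l o tau for some functional l; this l is the
    charge of y. *)
Lemma A_Theta_self_adjoint : self_adjoint AT.
Proof.
have [sA lA] := A_linear; have [[sT lT] _ _ _] := Theta_sa.
have lAT := A_Theta_linear; apply: self_adjoint_intro => //.
  move=> x y /A_Theta_elim[u [P [Du DP tu -> ->]]] /A_Theta_elim[v [Q [Dv DQ tv -> ->]]].
  rewrite hdotBl hdotBr (self_adjoint_sym A_sa Du Dv); congr (_ - _).
  rewrite (trace_adjoint_tau _ Dv) tv Theta_sym// -tu.
  by rewrite -(trace_adjoint_tau Q Du) -hdotC.
move=> y w yw.
(* That functional, with D(A) parametrized by the resolvent. *)
pose f h := hdot w (resolvent A z0 h) - hdot y (A (resolvent A z0 h)).
have [c _ Rc] := resolvent_bound z0_rho.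
have Rl := resolvent_linear A_linear z0_rho.
have DR := dom_resolvent z0_rho.
have [||h Bh|l lE] := @factor_functional z0 f
    (nrm w * c + nrm y * (nrm z0 * c + 1)) z0_rho.
- move=> a u v; rewrite /f Rl lA// !hdotDr !hdotZr scalerBr opprD.
  by rewrite -!/(_ *: _) addrACA.
- move=> h; rewrite /f (le_trans (nrmB _ _))// mulrDl lerD//.
    by rewrite (le_trans (nrm_hdot _ _))// -mulrA ler_wpM2l ?nrm_ge0.
  rewrite (le_trans (nrm_hdot _ _))// -mulrA ler_wpM2l ?nrm_ge0// op_resolvent//.
  rewrite (le_trans (nrmB _ _))// mulrDl mul1r lerD// nrmZ -mulrA.
  by rewrite ler_wpM2l ?nrm_ge0.
- have [D1 A1] := A_Theta_ker (DR h) Bh.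
  by rewrite /f (yw _ D1) A1 subrr.
have lf u : dom A u -> l (tau u) = hdot w u - hdot y (A u).
  move=> Du; have := lE (- A u + z0 *: u).
  by rewrite /f /breveG (resolvent_uniq z0_rho Du).
have [|D1 A1] := @self_adjoint_max _ _ A (y + trace_adjoint l) w A_sa.
  move=> x Dx; rewrite hdotDl (trace_adjoint_tau l Dx) lf//.
  by rewrite addrC subrK.
have [|Dl Tl] := @Theta_max l (tau (y + trace_adjoint l)).
  move=> m Dm; have [u Du tu] := h1 (Theta m).
  have [DAT AE] := A_Theta_mk Du Dm tu.
  have := yw _ DAT; rewrite AE hdotBr => h.
  have : l (Theta m) = hdot w (trace_adjoint m).
    by rewrite -tu lf// -h opprB addrC subrK.
  by move=> ->; rewrite -hdotC trace_adjointE -A1 TA.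
have [DAT AE] := A_Theta_mk D1 Dl (esym Tl).
by rewrite addrK in DAT AE; rewrite AE.
Qed.

(** * The resolvent formula *)

(** Write phi = psi - T' Q and h = (z - A_Theta) phi.  Then (z - A) psi equals
    h + z T' Q, so psi = R(z) (h + z T' Q); applying tau and tau psi = Theta Q
    gives the equation for the charge Q. *)
Lemma A_Theta_shift z phi : resolvent_set A z -> dom AT phi -> exists2 Q,
  dom Theta Q /\ Theta Q + Gamma A tau I z Q =
    breveG A tau z (op_shift AT z phi)
  & phi = resolvent A z (op_shift AT z phi) + G A tau z Q.
Proof.
move=> zA /A_Theta_elim[psi [Q [Dpsi DQ tE phiE ATE]]].
have [sA lA] := A_linear; have Db := dom_resolvent zA (trace_adjoint Q).
have Dz : dom A (z *: resolvent A z (trace_adjoint Q)) by exact: subspaceZ.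
have GQ := GE Q zA.
have RE : resolvent A z (op_shift AT z phi) = psi - z *: resolvent A z (trace_adjoint Q).
  apply: resolvent_uniq => //; first exact: subspaceB.
  rewrite [op_shift AT z phi]/(- AT phi + z *: phi) ATE phiE.
  rewrite (linear_onB sA lA)// (linear_onZ sA lA)// op_resolvent// !scalerBr.
  by rewrite opprB addrC addrA (addrA (_ - _)) subrK addrC.
exists Q.
  split=> //; rewrite /breveG RE -TA; last exact: subspaceB.
  rewrite (linear_onB sA lA)// (linear_onZ sA lA)// op_resolvent// -GQ.
  rewrite (GammaE) -tE -TA//.
  by rewrite addrC -!scaleNr -T_linear scaleNr addrC.
by rewrite RE GQ addrA subrK phiE.
Qed.

Lemma Theta_Gamma_add z l m a : resolvent_set A z -> dom Theta l -> dom Theta m ->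
  dom Theta (a *: l + m) /\
  Theta (a *: l + m) + Gamma A tau I z (a *: l + m) =
    a^* *: (Theta l + Gamma A tau I z l) + (Theta m + Gamma A tau I z m).
Proof.
move=> zA Dl Dm; have [[sT lT] _ _ _] := Theta_sa; have [sA lA] := A_linear.
split; first by apply: subspaceD => //; exact: subspaceZ.
have GZ : G A tau z (a *: l + m) = a^* *: G A tau z l + G A tau z m.
  rewrite !(GE _ zA) trace_adjoint_conj_linear.
  rewrite resolvent_linear// scalerDr opprD addrACA; congr (_ + _).
  by rewrite scalerBr !scalerA mulrC.
rewrite lT// !(GammaE) GZ T_linear.
rewrite scalerDr opprD addrACA; congr (_ + _); rewrite scalerDr; congr (_ + _).
by rewrite scalerN !scalerA mulrC.
Qed.

Lemma A_Theta_bound z (c : R) : resolvent_set A z ->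
  (forall l, dom Theta l -> nrm l <= c * nrm (Theta l + Gamma A tau I z l)) ->
  exists c' : R, forall phi, dom AT phi -> nrm phi <= c' * nrm (op_shift AT z phi).
Proof.
move=> zA cl; have [cR cR0 Rc] := resolvent_bound zA.
have [cB cB0 Bc] := breveG_bound zA.
pose cG := (nrm z * cR + 1) * `|cT|.
have cG0 : 0 <= cG.
  by rewrite mulr_ge0// addr_ge0// mulr_ge0// nrm_ge0.
have Gc l : nrm (G A tau z l) <= cG * nrm l.
  rewrite (GE _ zA) (le_trans (nrmB _ _))//.
  rewrite /cG -mulrA mulrDl mul1r lerD ?(nrm_trace_adjoint)//.
  rewrite nrmZ -mulrA ler_wpM2l ?nrm_ge0// (le_trans (Rc _))// ler_wpM2l//.
  exact: (nrm_trace_adjoint).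
exists (cR + cG * (`|c| * cB)) => phi Dphi.
have [Q [DQ QE] phiE] := A_Theta_shift zA Dphi.
rewrite {1}phiE (le_trans (nrmD _ _))// mulrDl lerD// (le_trans (Gc _))//.
rewrite -mulrA ler_wpM2l// (le_trans (cl _ DQ))// QE.
rewrite (le_trans (ler_wpM2r (nrm_ge0 _) (ler_norm c)))//.
by rewrite -mulrA ler_wpM2l.
Qed.

(** By A_Theta_shift the lower bounds pass to the self-adjoint operator A_Theta, so
    z is in its resolvent set.  Given x, choosing h with breveG(z) h = x and solving
    the resolvent equation for h then yields Q with (Theta + Gamma(z)) Q = x. *)
Lemma Krein_formula z (c c' : R) : resolvent_set A z ->
  (forall l, dom Theta l -> nrm l <= c * nrm (Theta l + Gamma A tau I z l)) ->
  (forall l, dom Theta l -> nrm l <= c' * nrm (Theta l + Gamma A tau I z^* l)) ->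
  [/\ resolvent_set AT z,
      boundedly_invertible (op_add Theta (op_everywhere (Gamma A tau I z)))
    & forall phi, resolvent AT z phi = resolvent A z phi +
        G A tau z (op_inv (op_add Theta (op_everywhere (Gamma A tau I z)))
                          (breveG A tau z phi))].
Proof.
move=> zA cz cz'; have zA' := resolvent_set_conj A_sa zA.
have [k kz] := A_Theta_bound zA cz; have [k' kz'] := A_Theta_bound zA' cz'.
have zAT : resolvent_set AT z.
  exact: bounded_below_resolvent A_Theta_self_adjoint kz kz'.
have solve h : exists2 Q, dom Theta Q /\
    Theta Q + Gamma A tau I z Q = breveG A tau z h
    & resolvent AT z h = resolvent A z h + G A tau z Q.
  have hE : op_shift AT z (resolvent AT z h) = h by have [] := op_invP zAT h.
  have [Q] := A_Theta_shift zA (dom_resolvent zAT h).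
  by rewrite hE; exists Q.
have inv : boundedly_invertible (op_add Theta (op_everywhere (Gamma A tau I z))).
  apply: (@boundedly_invertible_intro _ _ _ _ c) => /=.
  - move=> l m [Dl _] [Dm _]; have [D E] := Theta_Gamma_add (-1) zA Dm Dl.
    rewrite rmorphN rmorph1 !scaleN1r in D E.
    by rewrite addrC; split => //; rewrite E addrC.
  - by move=> l [Dl _]; exact: cz.
  - move=> x; have [h hx] := breveG_surj zA x.
    by have [Q [DQ QE] _] := solve h; exists Q => //; rewrite QE.
split=> // phi; have [Q [DQ QE] ->] := solve phi.
by congr (_ + G _ _ _ _); apply/esym/op_inv_uniq.
Qed.

(** With u := R(z) T' l one has G(z) l = A u, and l(Gamma(z) l) is the difference
    of z |A u|^2 and of the real number |z|^2 <u, A u>. *)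
Lemma Im_Gamma z (l : dual X) : resolvent_set A z ->
  complex.Im (l (Gamma A tau I z l)) = complex.Im z * nrm (G A tau z l) ^+ 2.
Proof.
move=> zA; rewrite (GammaE).
rewrite dualNr dualZ -trace_adjointE.
set u := resolvent A z (trace_adjoint l); have Du : dom A u by exact: dom_resolvent.
have Au : A u = z *: u - trace_adjoint l by rewrite op_resolvent.
rewrite (GE _ zA) -/u -Au.
have -> : trace_adjoint l = z *: u - A u by rewrite Au subKr.
rewrite hdotBl hdotZl hdot_nrm.
have : complex.Im (hdot u (A u)) = 0.
  have := hdotC u (A u); rewrite -(self_adjoint_sym A_sa Du Du).
  case: (hdot u (A u)) => x y [] /=; lra.
case: (hdot u (A u)) => x y /= ->; case: (z) => p q /=; ring.
Qed.

(** For l in the domain, l (Theta l) is real, so |l| |(Theta + Gamma(z)) l| is at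
    least |Im l(Gamma(z) l)| = |Im z| |G(z) l|^2, and G(z) is bounded below. *)
Lemma nonreal_bounded_below z : complex.Im z != 0 -> exists c : R,
  forall l, dom Theta l -> nrm l <= c * nrm (Theta l + Gamma A tau I z l).
Proof.
move=> z0'; have zA := nonreal_resolvent A_sa z0'.
have [C C0 GC] := G_bounded_below zA.
exists (C ^+ 2 / `|complex.Im z|) => l Dl.
have [->|l0] := eqVneq l 0.
  by rewrite nrm0 mulr_ge0 ?nrm_ge0// divr_ge0// sqr_ge0.
rewrite mulrAC ler_pdivlMr ?normr_gt0//.
rewrite -(@ler_pM2l _ (nrm l)) ?nrm_gt0//.
have Im0 : complex.Im (l (Theta l)) = 0.
  have := Theta_sym Dl Dl.
  case: (l (Theta l)) => x y [] /=; lra.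
have := le_trans (Im_le_nrm _) (nrm_dual l (Theta l + Gamma A tau I z l)).
rewrite dualDr raddfD/= Im0 add0r Im_Gamma// normrM.
rewrite [`|_ ^+ 2|]ger0_norm ?sqr_ge0// => h.
have : nrm l ^+ 2 <= C ^+ 2 * nrm (G A tau z l) ^+ 2.
  by rewrite -exprMn ler_pXn2r ?nnegrE ?mulr_ge0 ?nrm_ge0.
move=> l2; rewrite [leLHS]mulrA -[nrm l * nrm l]expr2.
rewrite (le_trans (ler_wpM2r (normr_ge0 (complex.Im z)) l2))//.
by rewrite -mulrA [nrm l * _]mulrCA ler_wpM2l ?sqr_ge0// mulrC.
Qed.

Lemma unit_bounded_below z (d : R) : resolvent_set A z -> 0 < d ->
  (forall l, dom Theta l -> nrm l = 1 -> d <= nrm (Theta l + Gamma A tau I z l)) ->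
  forall l, dom Theta l -> nrm l <= d^-1 * nrm (Theta l + Gamma A tau I z l).
Proof.
move=> zA d0 dl l Dl; have [[sT _] _ _ _] := Theta_sa.
have [->|l0] := eqVneq l 0; first by rewrite nrm0 mulr_ge0 ?nrm_ge0 ?invr_ge0 ?(ltW d0).
have nl := nrm_gt0 l0; have ni : 0 < (nrm l)^-1 by rewrite invr_gt0.
have D0 := subspace0 sT; have [_ E0] := Theta_Gamma_add (-1) zA D0 D0.
rewrite scaler0 add0r rmorphN rmorph1 scaleN1r addNr in E0.
have [Du] := Theta_Gamma_add (nrm l)^-1%:C zA Dl D0.
rewrite addr0 in Du *; rewrite E0 addr0 => E.
have := dl _ Du; rewrite E !nrmZ nrm_conj nrmR gtr0_norm// mulVf ?gt_eqF//.
by move=> /(_ erefl); rewrite ler_pdivlMl// ler_pdivlMl// mulrC.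
Qed.

(** On W the real part of l ((Theta + Gamma(z)) l), or its opposite, has a positive
    lower bound over the unit vectors l. *)
Lemma W_bounded_below z : (W_minus A tau I Theta `|` W_plus A tau I Theta) z ->
  [/\ resolvent_set A z, z^* = z & exists c : R,
    forall l, dom Theta l -> nrm l <= c * nrm (Theta l + Gamma A tau I z l)].
Proof.
have real (r : R) : (r%:C)^* = r%:C :> R[i] by rewrite /Num.conj /= oppr0.
have nl (l : dual X) x : nrm l = 1 -> nrm (l x : R[i]) <= nrm x.
  by move=> l1; rewrite (le_trans (nrm_dual _ _))// l1 mul1r.
case=> -[r -> [zA /gamma_bounded_below[d d0 dl]]]; split=> //; exists d^-1;
  apply: unit_bounded_below => // l Dl l1; apply: le_trans (nl l _ l1).
- apply: le_trans (dl l Dl Logic.I l1) _.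
  rewrite /= -dualDr -opprD dualNr -(nrmN (l _)); apply: le_trans (Re_le_nrm _).
  exact: ler_norm.
- apply: le_trans (dl l Dl Logic.I l1) _; rewrite -dualDr.
  by apply: le_trans (Re_le_nrm _); exact: ler_norm.
Qed.

End boundary.

Theorem theorem5 (R : realType) (H : hilbertType R)
    (X Dhat : completeNormedModType R[i])
    (A : operator H H) (tau : H -> X) (I : H -> Dhat)
    (Theta : operator (dual X) X) (z0 : R[i])
    (A_sa : self_adjoint A)
    (A_inj : forall x y, dom A x -> dom A y -> A x = A y -> x = y)
    (tau_linear : linear_on (dom A) tau)
    (tau_cont : graph_continuous A tau)
    (h1 : forall x : X, exists2 phi, dom A phi & tau phi = x)
    (h2 : range_adjoint A tau `&` embedded_dual A = [set fun=> 0])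
    (h3 : exists2 c : R[i], 0 < c &
       forall phi, dom A phi -> `|tau phi| <= c * `|A phi|)
    (I_completion : is_completion A I)
    (Theta_sa : conj_self_adjoint Theta)
    (z0_rho : resolvent_set A z0) :
  let AT := A_Theta A tau I Theta z0 in
  [/\ (* the pair (phi_reg, Q) exists for z iff it does for w, and is unique *)
      (forall z w phi phi_reg Q, resolvent_set A z -> resolvent_set A w ->
         decomposition A tau I z phi phi_reg Q ->
         decomposition A tau I w phi phi_reg Q) /\
      (forall phi phi_reg Q phi_reg' Q',
         decomposition A tau I z0 phi phi_reg Q ->
         decomposition A tau I z0 phi phi_reg' Q' ->
         phi_reg = phi_reg' /\ Q = Q'),
      forall phi phi_reg Q, admissible A tau I Theta z0 phi phi_reg Q ->
        AT phi = A_hat A I phi_reg,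
      self_adjoint AT,
      forall phi, dom A phi -> tau phi = 0 -> dom AT phi /\ AT phi = A phi
    & forall z, (W_minus A tau I Theta `|` W_plus A tau I Theta `|`
                 [set z | ~~ (z \is Num.real)]) z ->
        [/\ resolvent_set AT z,
            boundedly_invertible (op_add Theta (op_everywhere (Gamma A tau I z)))
          & forall phi, resolvent AT z phi = resolvent A z phi +
              G A tau z (op_inv (op_add Theta (op_everywhere (Gamma A tau I z)))
                                (breveG A tau z phi))]].
Proof.
have [T [cT [TA T_linear T_bound]]] :=
  trace_factorization A_sa A_inj tau_linear h3.
move=> AT; split.
- split=> [z w phi p Q zA wA|phi p Q p' Q'].
    have decP := decompositionP A_sa A_inj TA T_linear T_bound I_completion.
    by move=> /(decP _ _ _ _ zA)/(decP _ _ _ _ wA).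
  exact: (decomposition_uniq A_sa A_inj TA T_linear T_bound h1 h2 I_completion z0_rho).
- move=> phi p Q.
  exact: (admissible_value A_sa A_inj TA T_linear T_bound h1 h2 I_completion z0_rho).
- exact: (A_Theta_self_adjoint A_sa A_inj TA T_linear T_bound h1 h2 I_completion
    Theta_sa z0_rho).
- move=> phi.
  exact: (A_Theta_ker A_sa A_inj TA T_linear T_bound h1 h2 I_completion Theta_sa z0_rho).
- move=> z zW.
  have [zA [c cz] [c' cz']] : [/\ resolvent_set A z,
      exists c : R, forall l, dom Theta l ->
        nrm l <= c * nrm (Theta l + Gamma A tau I z l)
    & exists c : R, forall l, dom Theta l ->
        nrm l <= c * nrm (Theta l + Gamma A tau I z^* l)].
    case: zW => [/(W_bounded_below A_sa A_inj TA T_linear T_bound I_completion Theta_sa)|z_nr].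
      by move=> [zA zz cz]; rewrite zz.
    have z_Im : complex.Im z != 0.
      apply: contraNneq z_nr => z_Im.
      by rewrite realE !lecE z_Im /= eqxx/= le_total.
    have bb := nonreal_bounded_below A_sa A_inj TA T_linear T_bound h1 I_completion Theta_sa.
    have zA := nonreal_resolvent A_sa z_Im; split=> //; apply: bb => //.
    apply: contraNneq z_Im.
    by case: (z) => p q /= /eqP; rewrite oppr_eq0 => /eqP ->.
  exact: (Krein_formula A_sa A_inj TA T_linear T_bound h1 h2 I_completion Theta_sa z0_rho
    zA cz cz').
Qed.
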